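(* Let $n\ge 2$ and $\lambda>\frac{n-1}{4}$. There is a constant $c(n,\lambda)$, depending only on $n$ and $\lambda$, with the following property. Let $\mathbb{R}^n$ be endowed with a rotationally symmetric metric $$g=(dr)^2+J^2(r)(d\theta)^2,$$ where $J$ is smooth with $J(0)=0$ and $J'(0)=1$. If the Schrödinger operator $\Delta_g+\lambda\rho$ is non-negative, then for every $R>0$: $$\mathrm{vol}\,B(0,R)\le c(n,\lambda)\,R^n .$$
   Context: Here $(r,\theta)\in(0,\infty)\times\mathbb{S}^{n-1}$ are polar coordinates on $\mathbb{R}^n$, $(d\theta)^2$ is the round metric of the unit sphere $\mathbb{S}^{n-1}$, and $J\colon[0,\infty)\to[0,\infty)$ is positive on $(0,\infty)$ and such that $g$ extends to a smooth Riemannian metric on $\mathbb{R}^n$. For $x\in\mathbb{R}^n$, $\rho(x)$ is the lowest eigenvalue of the Ricci tensor of $g$ at $x$. $\Delta_g$ is the non-negative Laplace operator of $g$ and non-negativity of $\Delta_g+\lambda\rho$ means $$0\le\int_{\mathbb{R}^n}\left[|d\varphi|_g^2+\lambda\rho\,\varphi^2\right]\mathrm{dv}_g\quad\text{for all }\varphi\in C_0^\infty(\mathbb{R}^n).$$ $B(0,R)$ is the geodesic ball of $g$ centred at the origin, and $\mathrm{vol}$ is the Riemannian volume of $g$. *)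

(* Defs.v *)
From HB Require Import structures.
From mathcomp Require Import all_boot all_order all_algebra.
From mathcomp Require Import all_classical all_reals all_analysis.
Set Implicit Arguments.
Unset Strict Implicit.
Unset Printing Implicit Defensive.
Import Order.TTheory GRing.Theory Num.Theory.
Import numFieldNormedType.Exports.
Local Open Scope classical_set_scope.
Local Open Scope ring_scope.

(* Points and tangent vectors of R^n are
   row vectors; the norm of the library on 'rV_n is the sup norm and only its
   topology is used here.  A covariant 2-tensor on R^n is the matrix field of
   its components in the Cartesian coordinates. *)

Section LebesgueMeasureRn.
Variable R : realType.
Let T := measurableTypeR R.

Section Cons.
Variables (n : nat) (m : {sigma_finite_measure set (n.-tuple T) -> \bar R}).
Local Open Scope ereal_scope.

Definition cons_pair (p : T * n.-tuple T) : n.+1.-tuple T :=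
  [tuple of p.1 :: p.2].
Definition uncons_pair (t : n.+1.-tuple T) : T * n.-tuple T :=
  (thead t, [tuple of behead t]).

Definition cons_measure : set (n.+1.-tuple T) -> \bar R :=
  pushforward (@lebesgue_measure R \x m) cons_pair.

Lemma measurable_cons_pair : measurable_fun setT cons_pair.
Proof. exact: (measurable_cons measurable_fst measurable_snd). Qed.

Lemma measurable_uncons_pair : measurable_fun setT uncons_pair.
Proof.
apply: measurable_fun_pair; first exact: measurable_tnth.
exact: measurable_behead.
Qed.

Lemma cons_pairK : cancel cons_pair uncons_pair.
Proof. by move=> [x t]; congr (_, _); apply/val_inj. Qed.

Let cons_measure0 : cons_measure set0 = 0.
Proof. by rewrite /cons_measure /pushforward preimage_set0 measure0. Qed.

Let cons_measure_ge0 A : 0 <= cons_measure A.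
Proof. by rewrite /cons_measure /pushforward measure_ge0. Qed.

Let mpre A : measurable A -> measurable (cons_pair @^-1` A).
Proof.
by move=> mA; rewrite -[X in measurable X]setTI; exact: measurable_cons_pair.
Qed.

Let cons_measure_sigma_additive : semi_sigma_additive cons_measure.
Proof.
move=> F mF tF mUF; rewrite /cons_measure /pushforward preimage_bigcup.
apply: measure_semi_sigma_additive.
- by move=> k; exact: mpre.
- apply/trivIsetP => /= i j _ _ ij; rewrite -preimage_setI.
  by move/trivIsetP : tF => /(_ _ _ _ _ ij) ->//; rewrite preimage_set0.
- by rewrite -preimage_bigcup; exact: mpre.
Qed.

HB.instance Definition _ := isMeasure.Build _ _ _ cons_measure
  cons_measure0 cons_measure_ge0 cons_measure_sigma_additive.

Let cons_measure_sigma_finite : sigma_finite setT cons_measure.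
Proof.
have /sigma_finiteP[F [FT ndF Foo]] := sigma_finiteT (@lebesgue_measure R).
have /sigma_finiteP[G [GT ndG Goo]] := sigma_finiteT m.
exists (fun k => uncons_pair @^-1` (F k `*` G k)).
  rewrite -preimage_bigcup (_ : \bigcup_k _ = setT) ?preimage_setT//.
  rewrite -setXTT FT GT predeqE => -[x y]; split.
    by move=> [k _ []/= ? ?]; split; exists k.
  move=> [/= [k _ Fkx] [l _ Gly]]; exists (maxn k l) => //; split.
  - by move: x Fkx; exact/subsetPset/ndF/leq_maxl.
  - by move: y Gly; exact/subsetPset/ndG/leq_maxr.
move=> k; have [mFk Fk] := Foo k; have [mGk Gk] := Goo k; split.
  rewrite -[X in measurable X]setTI.
  by apply: measurable_uncons_pair => //; exact: measurableX.
rewrite /cons_measure /pushforward -comp_preimage.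
rewrite (_ : _ \o _ = idfun); last first.
  by apply/funext => p /=; rewrite cons_pairK.
by rewrite preimage_id product_measure1E// lte_mul_pinfty// ge0_fin_numE.
Qed.

HB.instance Definition _ := Measure_isSigmaFinite.Build _ _ _ cons_measure
  cons_measure_sigma_finite.

End Cons.

(* iterated product of one-dimensional Lebesgue measures *)
Fixpoint lebesgue_tuple n : {sigma_finite_measure set (n.-tuple T) -> \bar R} :=
  match n with
  | 0 => @dirac _ _ [tuple] R
  | n'.+1 => cons_measure (lebesgue_tuple n')
  end.

End LebesgueMeasureRn.

Definition row_of_tuple (R : realType) n (t : n.-tuple (measurableTypeR R)) :
  'rV[R]_n := \row_i (tnth t i : R).

Section Calculus.
Variables (R : realType) (n : nat).
Implicit Types (x v w : 'rV[R]_n) (f : 'rV[R]_n -> R).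

Definition partial (i : 'I_n) f x : R := 'D_(delta_mx 0 i) f x.

Fixpoint Ck k f : Prop :=
  continuous f /\
  if k is k'.+1 then
    forall i, (forall x, derivable f x (delta_mx 0 i)) /\ Ck k' (partial i f)
  else True.

Definition smooth f : Prop := forall k, Ck k f.

Definition test_function f : Prop :=
  smooth f /\ compact (closure [set x | f x != 0]).

Definition dot v w : R := \sum_i v 0 i * w 0 i.
Definition enorm x : R := Num.sqrt (dot x x).

Definition bilin (G : 'M[R]_n) v w : R := (v *m G *m w^T) 0 0.

End Calculus.

Section HalfLine.
Variable R : realType.

(* Only the values of J on [0, +oo[ matter; smoothness up to the boundary point
   0 means being the restriction of a smooth function on R. *)
Definition smooth_half_line (J : R -> R) : Prop :=
  exists F : R -> R, (forall k r, derivable (derive1n k F) r 1) /\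
                     (forall r, 0 <= r -> F r = J r).

Definition right_derivative_at0 (J : R -> R) (l : R) : Prop :=
  (fun h => (J h - J 0) / h) @ 0^'+ --> l.

End HalfLine.

Section Riemannian.
Variables (R : realType) (n : nat) (g : 'rV[R]_n -> 'M[R]_n).
Implicit Types (x y : 'rV[R]_n) (phi : 'rV[R]_n -> R).

Definition riemannian_metric : Prop :=
  [/\ forall i j, smooth (fun x => g x i j),
      forall x, (g x)^T = g x &
      forall x v, v != 0 -> 0 < bilin (g x) v v].

(* christoffel k i j is Gamma^k_{ij} *)
Definition christoffel (k i j : 'I_n) x : R :=
  2^-1 * \sum_l invmx (g x) k l *
    (partial i (fun y => g y j l) x + partial j (fun y => g y i l) x
     - partial l (fun y => g y i j) x).

(* R(e_i, e_j) e_k = \sum_l (riemann l i j k) e_l, with the convention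
   R(X, Y) Z = D_X D_Y Z - D_Y D_X Z - D_[X, Y] Z *)
Definition riemann (l i j k : 'I_n) x : R :=
  partial i (christoffel l j k) x - partial j (christoffel l i k) x
  + \sum_m (christoffel l i m x * christoffel m j k x
            - christoffel l j m x * christoffel m i k x).

(* Ric(Y, Z) is the trace of X |-> R(X, Y) Z; it is positive on round
   spheres *)
Definition ricci x : 'M[R]_n := \matrix_(j, k) \sum_i riemann i i j k x.

(* v is an eigenvector of the Ricci tensor with eigenvalue a when
   Ric(v, .) = a g(v, .), that is v *m ricci x = a *: (v *m g x).  For n > 0
   the set below is finite and nonempty, so that inf is its minimum. *)
Definition lowest_ricci x : R :=
  inf [set a | eigenvalue (ricci x *m invmx (g x)) a].

(* integral over D against the Riemannian volume sqrt (det g) dx *)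
Definition integral_dv (D : set 'rV[R]_n) (f : 'rV[R]_n -> R) : \bar R :=
  (\int[lebesgue_tuple R n]_(t in [set t | D (row_of_tuple t)])
     (f (row_of_tuple t) * Num.sqrt (\det (g (row_of_tuple t))))%:E)%E.

Definition volume (D : set 'rV[R]_n) : \bar R := integral_dv D (fun=> 1).

(* |d phi|_g^2 = g^{ij} (d_i phi) (d_j phi) *)
Definition sqnorm_d phi x : R :=
  let dphi := \row_i partial i phi x in bilin (invmx (g x)) dphi dphi.

Definition schrodinger_nonneg (lambda : R) : Prop :=
  forall phi, test_function phi ->
    (0 <= integral_dv setT
            (fun x => sqnorm_d phi x + lambda * lowest_ricci x * phi x ^+ 2)%R)%E.

Definition C1_curve (c : R -> 'rV[R]_n) : Prop :=
  (forall t, derivable c t 1) /\ continuous (derive1 c).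

Definition curve_length (c : R -> 'rV[R]_n) : \bar R :=
  (\int[@lebesgue_measure R]_(t in `[0%R, 1%R])
     (Num.sqrt (bilin (g (c t)) (derive1 c t) (derive1 c t)))%:E)%E.

(* A piecewise C^1 curve from x to y, cut into pieces that are each
   parametrised by [0, 1] (and extended to R). *)
Fixpoint piecewise_C1 x (s : seq (R -> 'rV[R]_n)) y : Prop :=
  if s is c :: s' then [/\ C1_curve c, c 0 = x & piecewise_C1 (c 1) s' y]
  else x = y.

Definition geodesic_dist x y : \bar R :=
  ereal_inf [set (\sum_(c <- s) curve_length c)%E
            | s in [set s | piecewise_C1 x s y]].

Definition geodesic_ball x (r : R) : set 'rV[R]_n :=
  [set y | (geodesic_dist x y < r%:E)%E].

(* g = (dr)^2 + J(r)^2 (dtheta)^2 away from the origin: with r(x) = |x| and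
   theta(x) = x / |x|, (dtheta)^2 is the pull-back by theta of the metric
   induced on the unit sphere by the Euclidean one. *)
Definition rotationally_symmetric (J : R -> R) : Prop :=
  forall x v w, x != 0 ->
    let theta := fun y : 'rV[R]_n => (enorm y)^-1 *: y in
    bilin (g x) v w =
      'D_v (@enorm R n) x * 'D_w (@enorm R n) x
      + J (enorm x) ^+ 2 * dot ('D_v theta x) ('D_w theta x).

End Riemannian.

(* Main.v *)
Require Import Defs.
From HB Require Import structures.
From mathcomp Require Import all_boot all_order all_algebra.
From mathcomp Require Import all_classical all_reals all_analysis.
From mathcomp Require Import measurable_realfun ring lra.
Import Order.TTheory GRing.Theory Num.Theory.
Import numFieldNormedType.Exports.
Local Open Scope classical_set_scope.
Local Open Scope ring_scope.
Set Implicit Arguments.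
Unset Strict Implicit.
Unset Printing Implicit Defensive.

(** The Ricci tensor has the eigenvalue
    [V = - J''/J + (n - 2) (1 - J'^2) / J^2] tangentially to the spheres, so
    [rho <= V] and testing with radial functions gives, in polar coordinates,
    [0 <= \int (phi'^2 + lambda V phi^2) J^(n-1) dr].  After integrating [J'']
    by parts the terms in [J'^2] cancel; a second integration by parts leaves,
    with [kappa = 2 lambda / (n - 1) > 1/2],
    [\int J^(n-1) (kappa phi phi'' + (kappa - 1) phi'^2) <=
     lambda (n - 2) \int J^(n-3) phi^2 + (boundary term at 0)].
    For [phi(r) = exp(- a / (1 - r / R))] with [a] large, the bracket on the
    left is at least [(lambda (n - 2) + 1) phi^2 / R^2], and
    [J^(n-3) <= J^(n-1) / R^2 + R^(n-3)] absorbs the right-hand side; hence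
    [\int_0^(R/2) J^(n-1) <= C R^n].  This [phi] has a conical tip at the
    origin, without which no gain is possible; it is approximated by
    [phi(sqrt (r^2 + e^2))], and the error is [O(e)] because
    [\int_0^R r e^2 (r^2 + e^2)^(-3/2) dr <= e]. *)

(** * Pointwise derivatives *)

(** Write [phi = u^alpha] with [alpha = kappa / (2 kappa - 1)]. Then [kappa phi phi'' + (kappa - 1)
    phi'^2 = kappa alpha u^(2 alpha - 1) u''], so the bracket has the sign of [u'']. The assumption
    [kappa > 1/2] makes [alpha] positive, so that a gain asks for a convex [u >= 0] that vanishes
    from [R] on. If such a [u] is positive at 0, its slope there is negative, whereas a smooth
    radial function has slope 0: this forces the cone. The exponential makes [phi] vanish smoothly
    at [R], and convexity of [u] becomes a lower bound on [a]. Smoothing the tip is delicate: with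
    [s = sqrt (r^2 + e^2)], the integral of the error [s'' = e^2 / s^3] over [[0, R]] tends to 1 and
    not to 0. It is the weight [J^(n-1)], at most a multiple of [r], that makes it [O(e)]. That
    multiple depends on the metric, but it disappears with [e] and leaves the final constant
    uniform. *)

Section PointwiseDerivatives.
Context (R : realType) (V : normedModType R).
Implicit Types (f g : V -> R) (x v : V).

Lemma is_derive_const (c : R) x v : is_derive x v (fun=> c) 0.
Proof. exact: is_derive_cst. Qed.

Lemma is_derive_add f g x v df dg : is_derive x v f df -> is_derive x v g dg ->
  is_derive x v (fun y => f y + g y) (df + dg).
Proof. by move=> ? ?; exact: is_deriveD. Qed.

Lemma is_derive_sub f g x v df dg : is_derive x v f df -> is_derive x v g dg ->
  is_derive x v (fun y => f y - g y) (df - dg).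
Proof. by move=> ? ?; exact: is_deriveB. Qed.

Lemma is_derive_mul f g x v df dg : is_derive x v f df -> is_derive x v g dg ->
  is_derive x v (fun y => f y * g y) (df * g x + f x * dg).
Proof.
move=> fv gv; have := @is_deriveM _ _ f g x v df dg fv gv.
by rewrite /GRing.scale/= addrC [g x * df]mulrC.
Qed.

Lemma is_derive_inv f x v df : f x != 0 -> is_derive x v f df ->
  is_derive x v (fun y => (f y)^-1) (- df / f x ^+ 2).
Proof.
move=> fx0 [fv <-]; split; first exact: derivableV.
by rewrite deriveV// /GRing.scale/= mulrC mulrN mulNr.
Qed.

Lemma is_derive_pow f n x v df : is_derive x v f df ->
  is_derive x v (fun y => f y ^+ n) (n%:R * f x ^+ n.-1 * df).
Proof.
move=> fv; rewrite (_ : (fun y => _) = f ^+ n); first exact: is_deriveX.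
by apply/funext => y; rewrite exprfctE.
Qed.

Lemma is_derive_bigsum n (f : 'I_n -> V -> R) (df : 'I_n -> R) x v :
  (forall i, is_derive x v (f i) (df i)) ->
  is_derive x v (fun y => \sum_i f i y) (\sum_i df i).
Proof.
move=> fdf; rewrite (_ : (fun y => _) = \sum_i f i); first exact: is_derive_sum.
by apply/funext => y; rewrite fct_sumE.
Qed.

Lemma line_derive f x v : 'D_v f x = 'D_1 (fun t : R => f (t *: v + x)) 0.
Proof.
rewrite /derive; set g1 := fun t => t^-1 *: _; set g2 := fun t => t^-1 *: _.
suff -> : g1 = g2 by [].
by rewrite funeqE /g1 /g2 => t /=; rewrite addr0 scale0r add0r [_%:A]mulr1.
Qed.

(** Restricting [f] to the line through [x] with direction [v] reduces this to the one-variable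
    chain rule, so derivability of [f] along [v] suffices and no total differential is involved. *)
Lemma is_derive_chain (h : R -> R) f x v (dh df : R) :
  is_derive (f x) 1 h dh -> is_derive x v f df ->
  is_derive x v (fun y => h (f y)) (dh * df).
Proof.
move=> hdh [fv fE].
pose l (t : R) := f (t *: v + x).
have dl : derivable l 0 1 := (derivable1P f x v).1 fv.
have l0 : l 0 = f x by rewrite /l scale0r add0r.
have lE : 'D_1 l 0 = df.
  by rewrite -fE -line_derive.
have dhl : is_derive (l 0) 1 h dh by rewrite l0.
have dll : is_derive (0 : R) 1 l df by split.
have [hl hlE] := is_derive1_comp dhl dll.
split; first by apply/(derivable1P (fun y => h (f y)) x v).
by rewrite -hlE (line_derive (fun y => h (f y))).
Qed.

End PointwiseDerivatives.

(** * Polar coordinates *)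

Section LebesgueTupleScaling.
Variable R : realType.
Let T := measurableTypeR R.
Local Open Scope ereal_scope.

(** The image of Lebesgue measure under multiplication by [a], multiplied by [a], agrees with
    Lebesgue measure on half-open intervals, hence everywhere. *)
Lemma ge0_integral_lebesgue_scale (a : R) (h : T -> \bar R) :
  (0 < a)%R -> measurable_fun [set: T] h -> (forall x, 0 <= h x) ->
  \int[@lebesgue_measure R]_x h x =
  a%:E * \int[@lebesgue_measure R]_x h (a * x)%R.
Proof.
move=> a0 mh h0; pose phi (x : T) : T := (a * x)%R.
have mphi : measurable_fun [set: T] phi by exact: measurable_funM.
pose mix := isMeasurableFun.Build _ _ _ _ _ mphi.
pose mp : {mfun T >-> T} := HB.pack phi mix.
rewrite -[X in a%:E * X](@ge0_integral_pushforward _ _ _ _ _ phi mphi lebesgue_measure setT h)//.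
have a0' : (0 <= a)%R by exact: ltW.
rewrite -[RHS](@ge0_integral_mscale _ _ _ (pushforward lebesgue_measure mp) setT measurableT (NngNum a0'))//.
apply: eq_measure_integral => A mA _.
apply: lebesgue_measure_unique => // _ [[x y]] xy <-/=.
have phiE : phi @^-1` `]x, y]%classic = `](a^-1 * x)%R, (a^-1 * y)%R]%classic.
  by apply/seteqP; split => t;
    rewrite /= !in_itv/= /phi ltr_pdivrMl// ler_pdivlMl.
transitivity (a%:E * lebesgue_measure (phi @^-1` `]x, y]%classic)) => //.
rewrite phiE !lebesgue_measure_itv/= !lte_fin ltr_pM2l ?invr_gt0//.
case: ifPn => _; last by rewrite mule0.
by rewrite -!EFinD -EFinM -mulrBr mulVKf// gt_eqF.
Qed.

Definition scale_tuple n (a : R) (t : n.-tuple T) : n.-tuple T :=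
  [tuple of map (fun x : T => (a * x)%R : T) t].

Lemma measurable_scale_tuple n a : measurable_fun setT (@scale_tuple n a).
Proof.
apply/measurable_fun_tnthP => i.
rewrite (_ : _ \o _ = fun t => (a * tnth t i)%R).
  by apply: measurable_funM => //; exact: measurable_tnth.
by apply/funext => t /=; rewrite tnth_map.
Qed.

Lemma cons_measureE n (m : {sigma_finite_measure set (n.-tuple T) -> \bar R})
    (A : set (n.+1.-tuple T)) :
  cons_measure m A =
  \int[@lebesgue_measure R]_x m (xsection (@cons_pair R n @^-1` A) x).
Proof. by []. Qed.

(** By induction on the dimension: the slice at [x] of the rescaled set is the rescaled slice at
    [a * x], and each coordinate contributes one factor [a]. *)
Lemma lebesgue_tuple_scale n (a : R) (A : set (n.-tuple T)) :
  (0 < a)%R -> measurable A ->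
  lebesgue_tuple R n A =
  (a ^+ n)%:E * lebesgue_tuple R n (@scale_tuple n a @^-1` A).
Proof.
move=> a0; elim: n A => [|n IHn] A mA.
  rewrite expr0 mul1e; congr (dirac _ _).
  by apply/seteqP; split => t /=; rewrite (tuple0 t) (tuple0 (scale_tuple _ _)).
rewrite [LHS]cons_measureE [in RHS]/= cons_measureE.
have mB : measurable (@cons_pair R n @^-1` A).
  by rewrite -[X in measurable X]setTI; exact: measurable_cons_pair.
have mS x : measurable (xsection (@cons_pair R n @^-1` A) x).
  exact: measurable_xsection.
have mf : measurable_fun [set: T]
    (fun x => lebesgue_tuple R n (xsection (@cons_pair R n @^-1` A) x)).
  exact: measurable_fun_xsection.
have secE x : @scale_tuple n a @^-1`
      xsection (@cons_pair R n @^-1` A) (a * x)%R =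
    xsection (@cons_pair R n @^-1` (@scale_tuple n.+1 a @^-1` A)) x.
  apply/seteqP; split => t; rewrite /= /xsection/= !inE/=.
    by rewrite [X in A X -> _](_ : _ = scale_tuple a (cons_pair (x, t)))//;
      exact/val_inj.
  by rewrite [X in A X -> _](_ : _ = cons_pair (a * x, scale_tuple a t)%R)//;
    exact/val_inj.
rewrite (ge0_integral_lebesgue_scale a0)// exprS EFinM -muleA; congr (_ * _).
under eq_integral do rewrite IHn// secE.
rewrite ge0_integralZl ?lee_fin ?exprn_ge0 ?ltW//.
apply: measurable_fun_xsection.
rewrite -[X in measurable X]setTI; apply: measurable_cons_pair => //.
by rewrite -[X in measurable X]setTI; exact: measurable_scale_tuple.
Qed.

Definition radius n (t : n.-tuple T) : R := enorm (row_of_tuple t).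

Lemma radiusE n (t : n.-tuple T) : radius t = Num.sqrt (\sum_i tnth t i ^+ 2)%R.
Proof.
by congr Num.sqrt; apply: eq_bigr => i _; rewrite mxE expr2.
Qed.

Lemma measurable_radius n : measurable_fun setT (@radius n).
Proof.
rewrite (_ : @radius n = fun t => Num.sqrt (\sum_i tnth t i ^+ 2)%R); last first.
  by apply/funext => t; exact: radiusE.
apply: (@measurableT_comp _ _ _ _ _ _ (@Num.sqrt R)).
  by apply: continuous_measurable_fun; exact: sqrt_continuous.
apply: measurable_sum => i; apply: measurable_funX; exact: measurable_tnth.
Qed.

Lemma radius_scale n (a : R) (t : n.-tuple T) :
  (0 <= a)%R -> radius (scale_tuple a t) = (a * radius t)%R.
Proof.
move=> a0; rewrite !radiusE.
rewrite (eq_bigr (fun i => a ^+ 2 * tnth t i ^+ 2)%R); last first.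
  by move=> i _; rewrite tnth_map exprMn.
by rewrite -mulr_sumr sqrtrM ?sqr_ge0// sqrtr_sqr ger0_norm.
Qed.

Lemma measurable_cube n :
  measurable [set t : n.-tuple T | forall i, `|tnth t i| < 1 :> R]%R.
Proof.
  rewrite (_ : mkset _ = \bigcap_(i in [set: 'I_n])
    ((fun t : n.-tuple T => tnth t i) @^-1` [set` `](-1 : R)%R, 1%R[])).
   apply: fin_bigcap_measurable => // i _.
   rewrite -[X in measurable X]setTI; exact: measurable_tnth.
 apply/seteqP; split => t /= tP i.
   by rewrite /= in_itv/= -ltr_norml.
 by have := tP i Logic.I; rewrite /= in_itv/= -ltr_norml.
Qed.

Lemma lebesgue_tuple_cube_lty n :
  lebesgue_tuple R n [set t | forall i, `|tnth t i| < 1 :> R]%R < +oo.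
Proof.
elim: n => [|n IHn].
  by rewrite /= /dirac indicE; case: (_ \in _); rewrite ltry.
have mC := @measurable_cube n.
rewrite [ltLHS]cons_measureE.
rewrite (_ : _ @^-1` _ = [set` `](-1 : R)%R, 1%R[] `*`
   [set t : n.-tuple T | forall i, `|tnth t i| < 1 :> R]%R).
  rewrite [ltLHS](product_measure1E _ _ _ mC)//.
  apply: lte_mul_pinfty => //.
  by have /= := lebesgue_measure_itv (`](-1 : R)%R, 1%R[); rewrite lte_fin => ->;
    case: ifP; rewrite -?EFinD.
apply/seteqP; split => -[x t] /=.
  move=> xt; split; first by have := xt ord0; rewrite in_itv/= -ltr_norml.
  by move=> i; have := xt (lift ord0 i); rewrite tnthS.
move=> [+ tP] i; rewrite in_itv/= -ltr_norml => xP.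
by case: (unliftP ord0 i) => [j|] -> //; rewrite tnthS.
Qed.

Lemma measurable_radius_lt n (x : R) :
  measurable [set t : n.-tuple T | radius t < x]%R.
Proof.
rewrite (_ : mkset _ = setT `&` (@radius n @^-1` `]-oo, x[%classic)).
  exact: measurable_radius.
by rewrite setTI; apply/seteqP; split => t; rewrite /= in_itv.
Qed.

Lemma lebesgue_tuple_unit_ball_lty n :
  lebesgue_tuple R n [set t | radius t < 1]%R < +oo.
Proof.
apply: le_lt_trans (lebesgue_tuple_cube_lty n); apply: le_measure.
- by rewrite inE; exact: measurable_radius_lt.
- by rewrite inE; exact: measurable_cube.
move=> t /= t1 i; apply: le_lt_trans t1.
rewrite radiusE -sqrtr_sqr ler_wsqrtr// (bigD1 i)//= lerDl.
by apply: sumr_ge0 => j _; exact: sqr_ge0.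
Qed.

Definition unit_ball_volume n : R :=
  fine (lebesgue_tuple R n [set t | radius t < 1]%R).


Lemma lebesgue_tuple_radius_lt n (x : R) :
  lebesgue_tuple R n.+1 [set t | radius t < x]%R =
  (if (0 < x)%R then unit_ball_volume n.+1 * x ^+ n.+1 else 0%R)%:E.
Proof.
case: ifPn => [x0|]; last first.
  rewrite -leNgt => x0; rewrite (_ : mkset _ = set0) ?measure0//.
  apply/seteqP; split => t //=.
  by apply/negP; rewrite -leNgt (le_trans x0)// /radius /enorm sqrtr_ge0.
rewrite (lebesgue_tuple_scale x0); last exact: measurable_radius_lt.
rewrite mulrC EFinM; congr (_ * _).
rewrite /unit_ball_volume fineK ?ge0_fin_numE//; last exact: lebesgue_tuple_unit_ball_lty.
congr (lebesgue_tuple _ _ _); apply/seteqP; split => t /=;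
  by rewrite radius_scale ?(ltW x0)// gtr_pMr.
Qed.

End LebesgueTupleScaling.

Lemma integral_is_derive (R : realType) (F f : R -> R) (a b : R) :
  a < b -> (forall x : R, is_derive x 1 F (f x)) -> continuous f ->
  (\int[@lebesgue_measure R]_(x in `[a, b]) (f x)%:E = (F b - F a)%:E)%E.
Proof.
move=> ab dF cf.
have cF : continuous F.
  by move=> x; apply/differentiable_continuous/derivable1_diffP; case: (dF x).
rewrite (@continuous_FTC2 _ _ F)//.
- exact: continuous_subspaceT.
- split; first by move=> x _; case: (dF x).
  + by apply: cvg_at_right_filter; exact: cF.
  + by apply: cvg_at_left_filter; exact: cF.
- by move=> x _; rewrite derive1E; case: (dF x).
Qed.

(** * Integration against a measure given by a density *)

Section Density.
Local Open Scope ereal_scope.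
Context d (T : measurableType d) (R : realType).
Variables (mu nu : {measure set T -> \bar R}) (h : T -> R).
Hypothesis mh : measurable_fun setT h.
Hypothesis h0 : forall x, (0 <= h x)%R.
Hypothesis nuE : forall A, measurable A -> nu A = \int[mu]_(x in A) (h x)%:E.

Let measurable_EFin_h : measurable_fun setT (EFin \o h).
Proof. exact/measurable_EFinP. Qed.

Import HBNNSimple.

(** The hypothesis [nuE] is the case of indicator functions; linearity gives simple functions, and
    monotone convergence on both sides gives the rest. *)
Lemma ge0_integral_density (f : T -> \bar R) :
  measurable_fun setT f -> (forall x, 0 <= f x) ->
  \int[nu]_x f x = \int[mu]_x (f x * (h x)%:E).
Proof.
move=> mf f0; pose f_ := nnsfun_approx measurableT mf.
have fcvg x : (f_ n x)%:E @[n --> \oo] --> f x.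
  by apply: cvg_nnsfun_approx => // *; exact: f0.
have fnd x : {homo (fun n => (f_ n x)%:E) : m n / (m <= n)%N >-> m <= n}.
  by move=> m n mn; rewrite lee_fin; exact/lefP/nd_nnsfun_approx.
transitivity (limn (fun n => \int[nu]_x (f_ n x)%:E)).
  rewrite -monotone_convergence//.
  - by apply: eq_integral => x _; apply/esym/cvg_lim => //; exact: fcvg.
  - by move=> n; exact/measurable_EFinP/measurable_funP.
  - by move=> n x _; rewrite lee_fin.
rewrite [X in limn X](_ : _ = (fun n => \int[mu]_x ((f_ n x)%:E * (h x)%:E))).
  rewrite -monotone_convergence//; last 3 first.
  - move=> n; apply: emeasurable_funM => //.
    exact/measurable_EFinP/measurable_funP.
  - by move=> n x _; rewrite mule_ge0// lee_fin.
  - by move=> x _ m n mn; rewrite lee_wpmul2r ?lee_fin//; exact: fnd.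
  apply: eq_integral => x _; apply/cvg_lim => //.
  by apply: cvgeZr => //; exact: fcvg.
apply/funext => n; rewrite integralT_nnsfun sintegralE.
have fE x : (f_ n x)%:E * (h x)%:E = \sum_(r \in range (f_ n))
    ((r * \1_(f_ n @^-1` [set r]) x)%:E * (h x)%:E).
  rewrite [in LHS](fimfunE (f_ n)) -fsumEFin// ge0_mule_fsuml//.
  by move=> r; rewrite EFinM nnfun_muleindic_ge0.
under [RHS]eq_integral do rewrite fE.
rewrite ge0_integral_fsum//; last 2 first.
  - move=> r; apply: emeasurable_funM => //.
    by apply/measurable_EFinP; apply: measurable_funM.
  - by move=> r x _; apply: mule_ge0; [rewrite EFinM nnfun_muleindic_ge0|rewrite lee_fin].
apply: eq_fsbigr => r; rewrite inE => -[t _ ftr]; rewrite nuE//.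
have r0 : (0 <= r)%R by rewrite -ftr.
rewrite [X in _ * X]integral_mkcond -ge0_integralZl//; last 2 first.
- have mS : measurable (f_ n @^-1` [set r]) by [].
  by apply/(measurable_restrictT (fun x => (h x)%:E) mS); exact: measurable_funTS.
- by move=> x _; rewrite /patch; case: ifP => //; rewrite lee_fin.
apply: eq_integral => x _; rewrite /patch /= EFinM indicE.
by case: ifPn => _; rewrite ?mule1// !mule0 mul0e.
Qed.

End Density.

Section PolarCoordinates.
Variable R : realType.
Local Open Scope ereal_scope.
Let T := measurableTypeR R.

(** In dimension [n.+1], the derivative in [r] of the volume of the ball of radius [r]; [n.+1] times
    the volume of the unit ball stands for the area of the unit sphere. *)
Definition radial_density n (r : R) : R :=
  if (0 < r)%R then (unit_ball_volume R n.+1 * (n.+1%:R * r ^+ n))%R else 0%R.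

Lemma unit_ball_volume_ge0 n : (0 <= unit_ball_volume R n)%R.
Proof. by rewrite fine_ge0. Qed.

Lemma radial_density_ge0 n r : (0 <= radial_density n r)%R.
Proof.
rewrite /radial_density; case: ifP => // /ltW r0.
by rewrite mulr_ge0 ?unit_ball_volume_ge0// mulr_ge0// exprn_ge0.
Qed.

Lemma measurable_radial_density n : measurable_fun setT (radial_density n).
Proof.
apply: measurable_fun_if => //.
- by apply: measurable_fun_ltr => //; exact: measurable_id.
- apply: measurable_funTS; apply: measurable_funM => //.
  by apply: measurable_funM => //; exact: measurable_funX.
Qed.

Lemma integral_radial_density n (x : R) :
  \int[@lebesgue_measure R]_(r in `]-oo, x[) (radial_density n r)%:E =
  lebesgue_tuple R n.+1 [set t | radius t < x]%R.
Proof.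
rewrite lebesgue_tuple_radius_lt; case: ifPn => [x0|]; last first.
  rewrite -leNgt => x0; apply: integral0_eq => r; rewrite /= in_itv/= => rx.
  by rewrite /radial_density ltNge (le_trans (ltW rx)).
pose f (r : R) := (unit_ball_volume R n.+1 * (n.+1%:R * r ^+ n))%R.
have cf : continuous f.
  by move=> r; apply: cvgM; [exact: cvg_cst|apply: cvgM; [exact: cvg_cst|exact: exprn_continuous]].
transitivity (\int[@lebesgue_measure R]_(r in `]0%R, x[) (f r)%:E).
  rewrite [LHS]integral_mkcond [RHS]integral_mkcond.
  apply: eq_integral => r _; rewrite /patch !mem_setE !in_itv/=.
  rewrite /radial_density; case: ifPn => rx; last by rewrite andbF.
  by rewrite andbT; case: ifP.
rewrite -(@integral_itv_bndoo _ _ _ _ true false); last first.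
  by apply/measurable_EFinP/measurable_funTS; exact: continuous_measurable_fun.
have dF (r : R) :
    is_derive r 1%R (fun r => unit_ball_volume R n.+1 * r ^+ n.+1)%R (f r).
  apply: is_derive_eq.
    apply: is_derive_mul.
    apply: (@is_derive_pow _ _ id); exact: is_derive_id.
  by rewrite mul0r add0r mulr1.
by rewrite (integral_is_derive x0 dF cf) expr0n/= mulr0 subr0.
Qed.

(** Only radial functions are integrated, so no measure on the sphere is required: the image of
    Lebesgue measure under [radius] and the measure with density [radial_density] agree on the rays
    []-oo, x[], which are stable under intersection, generate the Borel sets and exhaust the line
    with finite measure. *)
Lemma ge0_integral_radius n (f : T -> \bar R) :
  measurable_fun [set: T] f -> (forall r, 0 <= f r) ->
  \int[lebesgue_tuple R n.+1]_t f (radius t) =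
  \int[@lebesgue_measure R]_r (f r * (radial_density n r)%:E).
Proof.
move=> mf f0.
have mphi : measurable_fun [set: n.+1.-tuple T] (@radius R n.+1 : _ -> T).
  exact: measurable_radius.
pose nu : {measure set T -> \bar R} :=
  @measure_function_pushforward__canonical__measure_function_Measure
    _ _ _ _ _ (lebesgue_tuple R n.+1) _ mphi.
rewrite -[LHS](@ge0_integral_pushforward _ _ _ _ _ _ mphi (lebesgue_tuple R n.+1) setT f)//.
apply: (@ge0_integral_density _ _ _ lebesgue_measure nu) => //.
- exact: measurable_radial_density.
- exact: radial_density_ge0.
move=> A mA.
have mfE : measurable_fun [set: T] (EFin \o radial_density n : T -> \bar R).
  by apply/measurable_EFinP; exact: measurable_radial_density.
have fE0 (x : T) : 0 <= (EFin \o radial_density n) x.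
  by rewrite /= lee_fin radial_density_ge0.
pose m2 A := \int[@lebesgue_measure R]_(r in A) (radial_density n r)%:E.
have m20 : m2 set0 = 0 by rewrite /m2 integral_set0.
have m2ge B : 0 <= m2 B by apply: integral_ge0 => r _; exact: fE0.
pose m2M := isMeasure.Build _ _ _ m2 m20 m2ge
  (@semi_sigma_additive_nng_induced _ T R lebesgue_measure _ mfE fE0).
pose m2m : {measure set T -> \bar R} := HB.pack m2 m2M.
suff : nu A = m2m A by [].
move: A mA; apply: (@measure_unique _ R T (@RGenInftyO.G R) (fun k => [set` `]-oo, (k%:R : R)[%R])) => //.
- exact: RGenInftyO.measurableE.
- move=> _ _ [x ->] [y ->]; exists (Order.min x y).
  by apply/seteqP; split => r; rewrite /= !in_itv/= lt_min => /andP.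
- by move=> k; exists k%:R.
- rewrite -subTset => x _; exists (Num.truncn `|x|).+1 => //=.
  by rewrite in_itv/= (le_lt_trans (ler_norm x))// truncnS_gt.
- move=> _ [x ->]; rewrite [RHS]integral_radial_density.
  by congr (lebesgue_tuple _ _ _); apply/seteqP; split => t; rewrite /= in_itv.
- move=> k; rewrite [ltLHS](_ : _ = lebesgue_tuple R n.+1 [set t | radius t < k%:R]%R).
    by rewrite lebesgue_tuple_radius_lt ltry.
  by congr (lebesgue_tuple _ _ _); apply/seteqP; split => t; rewrite /= in_itv.
Qed.

End PolarCoordinates.

(** * Rotationally symmetric metrics *)

Section RadialCalculus.
Context (R : realType) (n : nat).
Implicit Types (x y v w : 'rV[R]_n).

Lemma is_derive_coord x v i : is_derive x v (fun y : 'rV[R]_n => y 0 i) (v 0 i).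
Proof.
have did : derivable (id : 'rV[R]_n -> 'rV[R]_n) x v by exact: derivable_id.
split; first exact: (derivable_mxP _ _ _).1 did 0 i.
by have := derive_mx did; rewrite derive_id => /rowP/(_ i); rewrite mxE => ->.
Qed.

Lemma dotC v w : dot v w = dot w v.
Proof. by apply: eq_bigr => i _; rewrite mulrC. Qed.

Lemma dot_ge0 x : 0 <= dot x x.
Proof. by apply: sumr_ge0 => i _; rewrite -expr2 sqr_ge0. Qed.

Lemma dot_gt0 x : x != 0 -> 0 < dot x x.
Proof.
move=> x0; rewrite lt_neqAle dot_ge0 andbT eq_sym; apply: contraNneq x0.
move=> /eqP; rewrite psumr_eq0; last by move=> i _; rewrite -expr2 sqr_ge0.
move=> /allP xi0; apply/eqP/rowP => i; rewrite mxE.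
by have := xi0 i (mem_index_enum _); rewrite /= mulf_eq0 orbb => /eqP.
Qed.

Lemma enorm_ge0 x : 0 <= enorm x.
Proof. exact: sqrtr_ge0. Qed.

Lemma enorm_gt0 x : x != 0 -> 0 < enorm x.
Proof. by move=> x0; rewrite sqrtr_gt0 dot_gt0. Qed.

Lemma enorm0 : enorm (0 : 'rV[R]_n) = 0.
Proof. by rewrite /enorm /dot big1 ?sqrtr0// => i _; rewrite mxE mul0r. Qed.

Lemma sqr_enorm x : enorm x ^+ 2 = dot x x.
Proof. by rewrite sqr_sqrtr// dot_ge0. Qed.

Lemma dotZl a v w : dot (a *: v) w = a * dot v w.
Proof. by rewrite /dot mulr_sumr; apply: eq_bigr => i _; rewrite mxE mulrA. Qed.

Lemma dotZr a v w : dot v (a *: w) = a * dot v w.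
Proof. by rewrite dotC dotZl dotC. Qed.

Lemma dotBl u v w : dot (u - v) w = dot u w - dot v w.
Proof.
rewrite /dot -sumrB; apply: eq_bigr => i _.
by rewrite mxE mulrDl mxE mulNr.
Qed.

Lemma dotBr u v w : dot w (u - v) = dot w u - dot w v.
Proof. by rewrite dotC dotBl !(dotC w). Qed.

Lemma dot_delta x i : dot x (delta_mx 0 i) = x 0 i.
Proof.
rewrite /dot (bigD1 i)//= mxE !eqxx mulr1 big1 ?addr0// => j ji.
by rewrite mxE (negbTE ji) andbF mulr0.
Qed.

Lemma is_derive_dot x v : is_derive x v (fun y => dot y y) (2 * dot x v).
Proof.
rewrite /dot mulr_sumr.
have dxi (i : 'I_n) : is_derive x v (fun y => y 0 i * y 0 i) (2 * (x 0 i * v 0 i)).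
  have := is_derive_mul (is_derive_coord x v i) (is_derive_coord x v i).
  by rewrite [v 0 i * _]mulrC -mulr2n mulr_natl.
exact: is_derive_bigsum.
Qed.

Lemma is_derive_enorm x v : x != 0 ->
  is_derive x v (@enorm R n) (dot x v / enorm x).
Proof.
move=> x0; have ds := is_derive1_sqrt (dot_gt0 x0).
have := @is_derive_chain _ _ Num.sqrt (fun y => dot y y) x v _ _ ds (is_derive_dot x v).
rewrite [X in is_derive _ _ _ X -> _](_ : _ = dot x v / enorm x)//.
rewrite -/(enorm x); have := enorm_gt0 x0 => /gt_eqF e0.
by field; rewrite e0.
Qed.

Lemma is_derive_radial (h : R -> R) x v dh : x != 0 ->
  is_derive (enorm x) 1 h dh ->
  is_derive x v (fun y => h (enorm y)) (dh * (dot x v / enorm x)).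
Proof. by move=> x0 hdh; exact: is_derive_chain hdh (is_derive_enorm v x0). Qed.

Lemma derive_direction x v : x != 0 ->
  'D_v (fun y : 'rV[R]_n => (enorm y)^-1 *: y) x =
  (enorm x)^-1 *: v - (dot x v / enorm x ^+ 3) *: x.
Proof.
move=> x0; have e0 : enorm x != 0 by rewrite gt_eqF// enorm_gt0.
have di (i : 'I_1) (j : 'I_n) :
    is_derive x v (fun y => ((enorm y)^-1 *: y) i j)
      ((enorm x)^-1 * v 0 j - dot x v / enorm x ^+ 3 * x 0 j).
  rewrite (_ : (fun y => _) = fun y => (enorm y)^-1 * y 0 j); last first.
    by apply/funext => y; rewrite mxE (ord1 i).
  have := is_derive_mul (is_derive_inv e0 (is_derive_enorm v x0)) (is_derive_coord x v j).
  by rewrite [X in is_derive _ _ _ X -> _](_ : _ =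
    (enorm x)^-1 * v 0 j - dot x v / enorm x ^+ 3 * x 0 j)//; field.
rewrite derive_mx; last by apply/derivable_mxP => i j; case: (di i j).
by apply/matrixP => i j; rewrite !mxE (ord1 i); case: (di 0 j) => _ ->.
Qed.

Lemma nonzero_nbhs x : x != 0 -> \forall y \near x, y != 0.
Proof.
move=> x0; have xx : y @[y --> x] --> x by exact: cvg_id.
exact: (cvgr_neq0 _ xx).
Qed.

Section MetricFormula.
Variables (g : 'rV[R]_n -> 'M[R]_n) (J : R -> R).
Hypothesis gJ : rotationally_symmetric g J.

(** [dot x v / r] is the radial component of [v]; the differential of the direction map kills it and
    divides the tangential component by [r]. *)
Lemma bilin_radial x v w : x != 0 ->
  let r := enorm x in
  bilin (g x) v w = dot x v * dot x w / r ^+ 2 +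
    J r ^+ 2 / r ^+ 2 * (dot v w - dot x v * dot x w / r ^+ 2).
Proof.
move=> x0 r; have r0 : r != 0 by rewrite gt_eqF// enorm_gt0.
rewrite (gJ v w x0) -/r !derive_direction// -/r.
have De u : 'D_u (@enorm R n) x = dot x u / r.
  by case: (is_derive_enorm u x0) => _ ->.
rewrite !De !(dotBl, dotBr, dotZl, dotZr) (dotC v x).
have -> : dot x x = r ^+ 2 by rewrite sqr_enorm.
by field.
Qed.

Lemma metric_entry x i j : x != 0 ->
  let r := enorm x in
  g x i j = J r ^+ 2 / r ^+ 2 * (i == j)%:R +
    (1 - J r ^+ 2 / r ^+ 2) / r ^+ 2 * (x 0 i * x 0 j).
Proof.
move=> x0 r; have r0 : r != 0 by rewrite gt_eqF// enorm_gt0.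
have -> : g x i j = bilin (g x) (delta_mx 0 i) (delta_mx 0 j).
  by rewrite /bilin -rowE trmx_delta -colE !mxE.
rewrite bilin_radial// -/r !dot_delta mxE eqxx/= (eq_sym j).
by field.
Qed.

End MetricFormula.

End RadialCalculus.

(** * Determinant and inverse of a scalar matrix plus a rank-one matrix *)

Section RankOneUpdate.
Variable R : realType.

(** One block matrix is factored in two ways, eliminating either [u] or [- v]. *)
Lemma det_add_rank1 n (u : 'cV[R]_n) (v : 'rV[R]_n) :
  \det (1%:M + u *m v) = 1 + (v *m u) 0 0.
Proof.
have E1 : block_mx 1%:M (- v) u 1%:M =
    block_mx 1%:M 0 u 1%:M *m block_mx 1%:M (- v) 0 (1%:M + u *m v) :> 'M[R]_(1 + n).
  by rewrite mulmx_block !(mulmx0, mul1mx, mul0mx, mulmx1, addr0, add0r) mulmxN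
    addrCA addNr addr0.
have E2 : block_mx 1%:M (- v) u 1%:M =
    block_mx 1%:M (- v) 0 1%:M *m block_mx (1%:M + v *m u) 0 u 1%:M :> 'M[R]_(1 + n).
  by rewrite mulmx_block !(mulmx0, mul1mx, mul0mx, mulmx1, addr0, add0r) mulNmx addrK.
have := congr1 determinant E1; rewrite E2 !det_mulmx !(det_ublock, det_lblock) !det1 !mul1r mulr1.
by move=> <-; rewrite det_mx11 !mxE.
Qed.

Lemma row_sqr_mx n (x : 'rV[R]_n) : x *m x^T = (dot x x)%:M.
Proof.
apply/matrixP => i j; rewrite !mxE !ord1 eqxx mulr1n.
by apply: eq_bigr => k _; rewrite mxE.
Qed.

Lemma det_scalar_rank1 n (x : 'rV[R]_n.+1) (a b : R) : a != 0 ->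
  \det (a%:M + b *: (x^T *m x)) = a ^+ n * (a + b * dot x x).
Proof.
move=> a0; have -> : a%:M + b *: (x^T *m x) = a *: (1%:M + ((b / a) *: x^T) *m x).
  by rewrite scalerDr scalemx1 -scalemxAl scalerA mulrCA divff// mulr1.
rewrite detZ det_add_rank1 -scalemxAr row_sqr_mx !mxE eqxx mulr1n exprS.
by field.
Qed.

(** The Sherman-Morrison formula with denominator [a + b * dot x x = 1]; for the metrics below this
    equation says that the radial direction has unit length. *)
Lemma invmx_scalar_rank1 n (x : 'rV[R]_n) (a b : R) : a != 0 ->
  a + b * dot x x = 1 ->
  invmx (a%:M + b *: (x^T *m x)) = a^-1 *: (1%:M - b *: (x^T *m x)).
Proof.
move=> a0 ab1; set G := a%:M + _; set H := a^-1 *: _.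
have xx : (x^T *m x) *m (x^T *m x) = dot x x *: (x^T *m x).
  by rewrite mulmxA -(mulmxA x^T) row_sqr_mx mul_mx_scalar scalemxAl.
have GH : G *m H = 1%:M.
  rewrite /G /H -scalemxAr mulmxBr mulmx1 -scalemxAr mulmxDl -scalemxAl xx.
  rewrite mul_scalar_mx -[in RHS](scale1r 1%:M) -[a%:M]scalemx1.
  move: (x^T *m x) => X; apply/matrixP => i j; rewrite !mxE.
  have -> : b * (a * X i j + b * (dot x x * X i j)) =
    b * (a + b * dot x x) * X i j by ring.
  by rewrite ab1; field.
have [Gu _] := mulmx1_unit GH.
by rewrite -[LHS]mulmx1 -GH mulmxA mulVmx// mul1mx.
Qed.

End RankOneUpdate.

Section DeltaSums.
Context (R : realType) (n : nat).
Implicit Types (x : 'rV[R]_n) (i j k : 'I_n).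

Lemma sum_delta (f : 'I_n -> R) i : \sum_l (l == i)%:R * f l = f i.
Proof.
rewrite (bigD1 i)//= eqxx mul1r big1 ?addr0// => l li.
by rewrite (negbTE li) mul0r.
Qed.

(** The five ways in which a curvature component depends on the index that is traced to obtain the
    Ricci tensor. *)
Lemma sum_trace x (c0 c1 c2 c3 c4 : R) i j :
  \sum_l (c0 + c1 * (x 0 l * x 0 l) + c2 * ((l == i)%:R * x 0 l) +
      c3 * ((l == j)%:R * x 0 l) + c4 * ((l == i)%:R * (l == j)%:R)) =
  c0 * n%:R + c1 * dot x x + c2 * x 0 i + c3 * x 0 j + c4 * (i == j)%:R.
Proof.
rewrite !big_split/= -!mulr_sumr !sum_delta.
by rewrite sumr_const card_ord -(mulr_natr c0).
Qed.

(** Contraction of two Christoffel symbols: each of them, as a function of the summed index, is a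
    combination of two Kronecker deltas and a coordinate. *)
Lemma sum_product x (p q s p' q' s' : R) a b c d :
  \sum_l ((p * (l == a)%:R + q * (l == b)%:R + s * x 0 l) *
      (p' * (l == c)%:R + q' * (l == d)%:R + s' * x 0 l)) =
  p * p' * (a == c)%:R + p * q' * (a == d)%:R + p * s' * x 0 a +
  q * p' * (b == c)%:R + q * q' * (b == d)%:R + q * s' * x 0 b +
  s * p' * x 0 c + s * q' * x 0 d + s * s' * dot x x.
Proof.
transitivity (\sum_l ((l == a)%:R * (p * (p' * (l == c)%:R + q' * (l == d)%:R + s' * x 0 l)) +
  (l == b)%:R * (q * (p' * (l == c)%:R + q' * (l == d)%:R + s' * x 0 l)) +
  (l == c)%:R * (s * p' * x 0 l) + (l == d)%:R * (s * q' * x 0 l) +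
  s * s' * (x 0 l * x 0 l))).
  by apply: eq_bigr => l _; ring.
rewrite !big_split/= !sum_delta -mulr_sumr -/(dot x x).
by ring.
Qed.

End DeltaSums.

(** * Curvature of the metric in Cartesian coordinates *)

Section RotationallySymmetricCurvature.
Context (R : realType) (n : nat) (g : 'rV[R]_n -> 'M[R]_n) (J F F1 F2 : R -> R).
Implicit Types (r : R) (x y v : 'rV[R]_n) (i j k l : 'I_n).
Hypothesis gJ : rotationally_symmetric g J.
Hypothesis FJ : forall r, 0 <= r -> F r = J r.
Hypothesis J_gt0 : forall r, 0 < r -> 0 < J r.
Hypothesis dF : forall r : R, is_derive r 1 F (F1 r).
Hypothesis dF1 : forall r : R, is_derive r 1 F1 (F2 r).

Let F_neq0 r : 0 < r -> F r != 0.
Proof. by move=> r0; rewrite FJ ?ltW// gt_eqF// J_gt0. Qed.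

(* On sphere-tangential vectors [g] is the Euclidean metric times [conf], and
   [g = conf I + defect x^T x] in Cartesian coordinates. *)
Definition conf r := F r ^+ 2 / r ^+ 2.
Definition conf1 r := 2 * F r * F1 r / r ^+ 2 - 2 * F r ^+ 2 / r ^+ 3.
Definition defect r := (1 - conf r) / r ^+ 2.
Definition defect1 r := - conf1 r / r ^+ 2 - 2 * (1 - conf r) / r ^+ 3.

Lemma conf_neq0 r : 0 < r -> conf r != 0.
Proof.
by move=> r0; rewrite mulf_neq0 ?invr_neq0 ?expf_neq0 ?F_neq0 ?gt_eqF.
Qed.

Lemma conf_defect r : 0 < r -> conf r + defect r * r ^+ 2 = 1.
Proof. by move=> r0; rewrite /defect; field; rewrite gt_eqF. Qed.

Let metricE x i j : x != 0 -> g x i j =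
  conf (enorm x) * (i == j)%:R + defect (enorm x) * (x 0 i * x 0 j).
Proof.
by move=> x0; rewrite (metric_entry gJ)// /defect /conf FJ// enorm_ge0.
Qed.

Lemma metric_mx x : x != 0 ->
  g x = (conf (enorm x))%:M + defect (enorm x) *: (x^T *m x).
Proof.
move=> x0; apply/matrixP => i j; rewrite metricE// !mxE big_ord1 !mxE.
by rewrite mulr_natr.
Qed.

Lemma invmx_metric x : x != 0 ->
  invmx (g x) = (conf (enorm x))^-1 *: (1%:M - defect (enorm x) *: (x^T *m x)).
Proof.
move=> x0; have r0 := enorm_gt0 x0.
rewrite metric_mx// invmx_scalar_rank1 ?conf_neq0//.
by rewrite -sqr_enorm conf_defect.
Qed.

Let is_derive_invX m r : r != 0 ->
  is_derive r 1 (fun s : R => (s ^+ m)^-1) (- m%:R / r ^+ m.+1).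
Proof.
move=> r0; have rm0 : r ^+ m != 0 by rewrite expf_neq0.
apply: (is_derive_eq (@is_derive_inv _ _ (fun s : R => s ^+ m) r 1 _ rm0
  (@is_derive_pow _ _ id m r 1 1 _))).
case: m rm0 => [|m] rm0; first by rewrite !(mul0r, oppr0).
by rewrite /= !exprS; field; rewrite r0 expf_neq0.
Qed.

Lemma is_derive_conf r : 0 < r -> is_derive r 1 conf (conf1 r).
Proof.
move=> r0; have rn0 : r != 0 by rewrite gt_eqF.
apply: (is_derive_eq (is_derive_mul (is_derive_pow 2 (dF r)) (is_derive_invX 2 rn0))).
by rewrite /conf1; field.
Qed.

Lemma is_derive_defect r : 0 < r -> is_derive r 1 defect (defect1 r).
Proof.
move=> r0; have rn0 : r != 0 by rewrite gt_eqF.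
apply: (is_derive_eq (is_derive_mul
  (is_derive_sub (is_derive_const 1 r 1) (is_derive_conf r0)) (is_derive_invX 2 rn0))).
by rewrite /defect1; field.
Qed.

Lemma partial_metric i j l x : x != 0 ->
  let r := enorm x in
  partial i (fun y => g y j l) x =
  conf1 r / r * x 0 i * (j == l)%:R + defect1 r / r * x 0 i * x 0 j * x 0 l +
  defect r * ((j == i)%:R * x 0 l + x 0 j * (l == i)%:R).
Proof.
move=> x0 r; have r0 : 0 < r := enorm_gt0 x0.
have rn0 : r != 0 by rewrite gt_eqF.
pose G y := conf (enorm y) * (j == l)%:R + defect (enorm y) * (y 0 j * y 0 l).
have GE : \forall y \near x, G y = g y j l.
  by near=> y; rewrite metricE//; near: y; exact: nonzero_nbhs.
have dG := is_derive_add
  (is_derive_mul (is_derive_radial (delta_mx 0 i) x0 (is_derive_conf r0))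
     (is_derive_const (j == l)%:R x (delta_mx 0 i)))
  (is_derive_mul (is_derive_radial (delta_mx 0 i) x0 (is_derive_defect r0))
     (is_derive_mul (is_derive_coord x (delta_mx 0 i) j)
        (is_derive_coord x (delta_mx 0 i) l))).
rewrite /partial; have [_ ->] := near_eq_is_derive GE dG.
rewrite -/r dot_delta !mxE !eqxx/=.
by field.
Unshelve. all: by end_near. Qed.

(** The Christoffel symbols are rotation-equivariant and symmetric in the lower indices;
    [gamma_tan], [gamma_diag] and [gamma_rad] are their coefficients along
    [x_i delta_jk + x_j delta_ik], [delta_ij x_k] and [x_i x_j x_k]. *)
Definition gamma_tan r := F1 r / (F r * r) - (r ^+ 2)^-1.
Definition gamma_diag r := (r ^+ 2)^-1 - F r * F1 r / r ^+ 3.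
Definition gamma_rad r :=
  (r ^+ 4)^-1 + F r * F1 r / r ^+ 5 - 2 * F1 r / (F r * r ^+ 3).

Lemma christoffelE k i j x : x != 0 ->
  let r := enorm x in
  christoffel g k i j x =
  gamma_tan r * (x 0 i * (j == k)%:R + x 0 j * (i == k)%:R) +
  gamma_diag r * (i == j)%:R * x 0 k + gamma_rad r * x 0 i * x 0 j * x 0 k.
Proof.
move=> x0 r; have r0 : 0 < r := enorm_gt0 x0.
have rn0 : r != 0 by rewrite gt_eqF.
have Fn0 := F_neq0 r0.
pose a1 := conf1 r / r; pose b1 := defect1 r / r.
rewrite /christoffel invmx_metric// -/r.
(* The term with coefficient 0 is padding that gives the inverse metric the shape expected by
   [sum_product]. *)
have -> : \sum_l ((conf r)^-1 *: (1%:M - defect r *: (x^T *m x))) k l *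
    (partial i (fun y => g y j l) x + partial j (fun y => g y i l) x -
     partial l (fun y => g y i j) x) =
  (conf r)^-1 * \sum_l ((1 * (l == k)%:R + 0 * (l == k)%:R + (- defect r * x 0 k) * x 0 l) *
     (a1 * x 0 i * (l == j)%:R + a1 * x 0 j * (l == i)%:R +
      (b1 * x 0 i * x 0 j + (2 * defect r - a1) * (i == j)%:R) * x 0 l)).
  rewrite mulr_sumr; apply: eq_bigr => l _.
  rewrite !partial_metric// !mxE big_ord1 !mxE -/r -/a1 -/b1.
  rewrite (eq_sym k l) (eq_sym j l) (eq_sym i l) (eq_sym j i) -mulr_natr.
  by ring.
rewrite sum_product -sqr_enorm -/r (eq_sym k j) (eq_sym k i).
rewrite /gamma_tan /gamma_diag /gamma_rad /a1 /b1 /conf /conf1 /defect1 /defect /conf1 /conf.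
by field; rewrite rn0 Fn0.
Qed.

(** No formula for the derivative is recorded: in the Ricci tensor the derivative of [gamma_tan]
    enters only the coefficient of [x_j x_k], and that of [gamma_rad] cancels by the antisymmetry of
    the curvature. Only the derivative of [gamma_diag] reaches the tangential eigenvalue. *)
Let is_derive_gamma_tan r : 0 < r -> {t : R | is_derive r 1 gamma_tan t}.
Proof.
move=> r0; have rn0 : r != 0 by rewrite gt_eqF.
have Fr0 : F r * r != 0 by rewrite mulf_neq0// F_neq0.
have dFr : is_derive r 1 (fun s : R => F s * s) (F1 r * r + F r * 1).
  exact: is_derive_mul (dF r) (is_derive_id r 1).
have H := is_derive_sub (is_derive_mul (dF1 r)
  (@is_derive_inv _ _ (fun s : R => F s * s) _ _ _ Fr0 dFr)) (is_derive_invX 2 rn0).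
by eexists; exact: H.
Qed.

Definition gamma_diag1 r :=
  - 2 / r ^+ 3 - (F1 r ^+ 2 + F r * F2 r) / r ^+ 3 + 3 * F r * F1 r / r ^+ 4.

Let is_derive_gamma_diag r : 0 < r -> is_derive r 1 gamma_diag (gamma_diag1 r).
Proof.
move=> r0; have rn0 : r != 0 by rewrite gt_eqF.
apply: (is_derive_eq (is_derive_sub (is_derive_invX 2 rn0)
  (is_derive_mul (is_derive_mul (dF r) (dF1 r)) (is_derive_invX 3 rn0)))).
by rewrite /gamma_diag1; field.
Qed.

Let is_derive_gamma_rad r : 0 < r -> {c : R | is_derive r 1 gamma_rad c}.
Proof.
move=> r0; have rn0 : r != 0 by rewrite gt_eqF.
have Fr0 : F r * r ^+ 3 != 0 by rewrite mulf_neq0 ?F_neq0// expf_neq0.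
have dr3 : is_derive r 1 (fun s : R => F s * s ^+ 3)
    (F1 r * r ^+ 3 + F r * (3%:R * r ^+ 2 * 1)).
  exact: is_derive_mul (dF r) (@is_derive_pow _ _ id 3 r 1 1 (is_derive_id r 1)).
have d1 := is_derive_add (is_derive_invX 4 rn0)
  (is_derive_mul (is_derive_mul (dF r) (dF1 r)) (is_derive_invX 5 rn0)).
have d2 := is_derive_mul (is_derive_mul (is_derive_const 2 r 1) (dF1 r))
  (@is_derive_inv _ _ (fun s : R => F s * s ^+ 3) _ _ _ Fr0 dr3).
by eexists; exact: is_derive_sub d1 d2.
Qed.

Let partial_christoffel (t c : R) l k i j x : x != 0 ->
  let r := enorm x in
  is_derive r 1 gamma_tan t -> is_derive r 1 gamma_rad c ->
  partial l (christoffel g k i j) x =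
  t / r * x 0 l * (x 0 i * (j == k)%:R + x 0 j * (i == k)%:R) +
  gamma_tan r * ((i == l)%:R * (j == k)%:R + (j == l)%:R * (i == k)%:R) +
  gamma_diag1 r / r * x 0 l * (i == j)%:R * x 0 k +
  gamma_diag r * (i == j)%:R * (k == l)%:R +
  c / r * x 0 l * x 0 i * x 0 j * x 0 k +
  gamma_rad r * ((i == l)%:R * x 0 j * x 0 k + x 0 i * (j == l)%:R * x 0 k +
    x 0 i * x 0 j * (k == l)%:R).
Proof.
move=> x0 r dt dc; have r0 : 0 < r := enorm_gt0 x0.
have rn0 : r != 0 by rewrite gt_eqF.
pose G y :=
  gamma_tan (enorm y) * (y 0 i * (j == k)%:R + y 0 j * (i == k)%:R) +
  gamma_diag (enorm y) * (i == j)%:R * y 0 k +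
  gamma_rad (enorm y) * y 0 i * y 0 j * y 0 k.
have GE : \forall y \near x, G y = christoffel g k i j y.
  by near=> y; rewrite christoffelE//; near: y; exact: nonzero_nbhs.
pose e : 'rV[R]_n := delta_mx 0 l.
have dx m := is_derive_coord x e m.
have dcst b := is_derive_const (b : R) x e.
have dG := is_derive_add (is_derive_add
  (is_derive_mul (is_derive_radial e x0 dt)
     (is_derive_add (is_derive_mul (dx i) (dcst (j == k)%:R))
        (is_derive_mul (dx j) (dcst (i == k)%:R))))
  (is_derive_mul (is_derive_mul (is_derive_radial e x0 (is_derive_gamma_diag r0))
     (dcst (i == j)%:R)) (dx k)))
  (is_derive_mul (is_derive_mul (is_derive_mul (is_derive_radial e x0 dc)
     (dx i)) (dx j)) (dx k)).
rewrite /partial; have [_ ->] := near_eq_is_derive GE dG.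
rewrite -/r /e dot_delta !mxE !eqxx/=.
by field.
Unshelve. all: by end_near. Qed.

Definition tangential_ricci r :=
  - F2 r / F r + (n%:R - 2) * (1 - F1 r ^+ 2) / F r ^+ 2.

(* The coefficient [q] is irrelevant on vectors orthogonal to [x]. *)
Lemma ricci_entry x : x != 0 -> let r := enorm x in
  exists q, forall j k,
    ricci g x j k = conf r * tangential_ricci r * (j == k)%:R + q * (x 0 j * x 0 k).
Proof.
move=> x0 r; have r0 : 0 < r := enorm_gt0 x0.
have rn0 : r != 0 by rewrite gt_eqF.
have Fn0 := F_neq0 r0.
have [t1 dt] := is_derive_gamma_tan r0.
have [c1 dc] := is_derive_gamma_rad r0.
pose t := t1 / r; pose b := gamma_diag1 r / r; pose c := c1 / r.
pose T := gamma_tan r; pose D := gamma_diag r; pose p := gamma_rad r.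
exists (n%:R * (p - t + T ^+ 2 + T * p * r ^+ 2) +
  (t - p - T ^+ 2 - T * p * r ^+ 2) + (p - b - D ^+ 2 - p * D * r ^+ 2)) => j k.
rewrite mxE; pose d := (j == k)%:R : R.
have S3 i : \sum_m christoffel g i i m x * christoffel g m j k x =
    \sum_m (((T + D) * x 0 i * (m == i)%:R + 0 * (m == i)%:R +
               (T + p * x 0 i ^+ 2) * x 0 m) *
      (T * x 0 j * (m == k)%:R + T * x 0 k * (m == j)%:R +
        (D * d + p * x 0 j * x 0 k) * x 0 m)).
  apply: eq_bigr => m _; rewrite !christoffelE// -/r -/T -/D -/p eqxx/=.
  by rewrite (eq_sym i m) (eq_sym k m) (eq_sym j m) -/d; ring.
have S4 i : \sum_m christoffel g i j m x * christoffel g m i k x =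
    \sum_m ((T * x 0 j * (m == i)%:R + D * x 0 i * (m == j)%:R +
               (T * (i == j)%:R + p * x 0 i * x 0 j) * x 0 m) *
      (T * x 0 i * (m == k)%:R + T * x 0 k * (m == i)%:R +
        (D * (i == k)%:R + p * x 0 i * x 0 k) * x 0 m)).
  apply: eq_bigr => m _; rewrite !christoffelE// -/r -/T -/D -/p.
  by rewrite (eq_sym i m) (eq_sym k m) (eq_sym j m) (eq_sym j i); ring.
(* The summand is sorted by its dependence on the traced index [i], in the five shapes of
   [sum_trace]. *)
transitivity (\sum_i (
  (D * d + p * x 0 j * x 0 k - t * x 0 j * x 0 k - T * d +
     T * (2 * T * x 0 j * x 0 k + (D * d + p * x 0 j * x 0 k) * r ^+ 2) -
     T ^+ 2 * x 0 j * x 0 k) +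
  (b * d - p * d + (T + D) * (D * d + p * x 0 j * x 0 k) +
     p * (2 * T * x 0 j * x 0 k + (D * d + p * x 0 j * x 0 k) * r ^+ 2) -
     (T * p * x 0 j * x 0 k + D * T * d + D * p * x 0 j * x 0 k +
       p * x 0 j * (2 * T * x 0 k + p * x 0 k * r ^+ 2))) * (x 0 i * x 0 i) +
  (t * x 0 k - p * x 0 k + (T + D) * T * x 0 k - D * T * x 0 k -
     T * (2 * T * x 0 k + p * x 0 k * r ^+ 2)) * ((i == j)%:R * x 0 i) +
  (p * x 0 j - b * x 0 j + (T + D) * T * x 0 j - T ^+ 2 * x 0 j -
     T * D * x 0 j - D ^+ 2 * x 0 j - p * x 0 j * D * r ^+ 2) *
     ((i == k)%:R * x 0 i) +
  (T - D - T * D * r ^+ 2) * ((i == j)%:R * (i == k)%:R))).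
  apply: eq_bigr => i _; rewrite /riemann sumrB S3 S4 !sum_product.
  rewrite !(partial_christoffel _ _ _ _ x0 dt dc) -/r -/T -/D -/p -/t -/b -/c.
  rewrite !eqxx/= (eq_sym j i) (eq_sym k i) (eq_sym k j) -/d -sqr_enorm -/r.
  by ring.
rewrite sum_trace -sqr_enorm -/r -/d.
have -> : conf r * tangential_ricci r =
    n%:R * (D - T + T * D * r ^+ 2) +
    r ^+ 2 * (b - p + (T + D) * D + p * D * r ^+ 2 - D * T) +
    T - D - T * D * r ^+ 2.
  rewrite /conf /tangential_ricci /T /D /p /b /gamma_tan /gamma_diag /gamma_rad.
  by rewrite /gamma_diag1; field; rewrite rn0 Fn0.
by ring.
Qed.

(** For [n >= 2] there is a nonzero vector orthogonal to [x]; on it the rank-one parts of the Ricci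
    tensor and of the inverse metric vanish, and [conf] cancels. *)
Lemma tangential_eigenvalue x : (2 <= n)%N -> x != 0 ->
  eigenvalue (ricci g x *m invmx (g x)) (tangential_ricci (enorm x)).
Proof.
move=> n2 x0; set r := enorm x; have r0 : 0 < r := enorm_gt0 x0.
have [q ricE] := ricci_entry x0; rewrite -/r in ricE.
have ker0 : kermx x^T != 0.
  rewrite -mxrank_eq0 mxrank_ker -lt0n subn_gt0 (leq_ltn_trans _ n2)//.
  by rewrite rank_leq_col.
apply/eigenvalueP; exists (nz_row (kermx x^T)); last by rewrite nz_row_eq0.
set v := nz_row _.
have vx : v *m x^T = 0 by apply/sub_kermxP; exact: nz_row_sub.
have -> : ricci g x = (conf r * tangential_ricci r)%:M + q *: (x^T *m x).
  apply/matrixP => j k; rewrite ricE !mxE big_ord1 !mxE.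
  by rewrite mulr_natr.
rewrite mulmxA mulmxDr -scalemxAr (mulmxA v) vx mul0mx scaler0 addr0.
rewrite mul_mx_scalar invmx_metric// -/r -scalemxAr -scalemxAl mulmxBr mulmx1.
rewrite -scalemxAr (mulmxA v) vx mul0mx scaler0 subr0 scalerA.
by rewrite mulrA mulVf ?mul1r// conf_neq0.
Qed.

(** An infimum is below each element only if the set is bounded below. The bound on the eigenvalues
    comes from reading the eigenvector equation at a component of largest absolute value. *)
Lemma lowest_ricci_le x : (2 <= n)%N -> x != 0 ->
  lowest_ricci g x <= tangential_ricci (enorm x).
Proof.
move=> n2 x0; apply: ge_inf; last exact: tangential_eigenvalue.
set M := _ *m _; exists (- \sum_i \sum_j `|M i j|) => a /= /eigenvalueP[v vM v0].
have [i vi0] : exists i, v 0 i != 0 by apply/rV0Pn.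
have [k _ kmax] := @arg_maxP _ R _ i xpredT (fun j => `|v 0 j|) isT.
have vk0 : 0 < `|v 0 k| by rewrite (lt_le_trans _ (kmax i isT))// normr_gt0.
suff : `|a| * `|v 0 k| <= (\sum_i \sum_j `|M i j|) * `|v 0 k|.
  by rewrite ler_pM2r// => /(le_trans _); rewrite lerNl; apply; rewrite -normrN ler_norm.
rewrite -normrM; have /rowP/(_ k) := vM; rewrite !mxE => <-.
rewrite (le_trans (ler_norm_sum _ _ _))// mulr_suml ler_sum// => j _.
rewrite normrM mulrC ler_pM//; last exact: (kmax j isT).
by rewrite (bigD1 k)//= lerDl sumr_ge0.
Qed.

(** The inverse metric fixes [x], so radial covectors keep their Euclidean length. *)
Lemma sqnorm_d_radial (phi : 'rV[R]_n -> R) x (d : R) : x != 0 ->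
  (forall i, partial i phi x = d * (x 0 i / enorm x)) ->
  sqnorm_d g phi x = d ^+ 2.
Proof.
move=> x0 dphi; rewrite /sqnorm_d; set r := enorm x.
have r0 : 0 < r := enorm_gt0 x0.
have -> : \row_i partial i phi x = (d / r) *: x.
  by apply/rowP => i; rewrite !mxE dphi -/r mulrA mulrAC.
have xx : x *m x^T = (r ^+ 2)%:M by rewrite sqr_enorm; exact: row_sqr_mx.
have xI : x *m invmx (g x) = x.
  rewrite invmx_metric// -/r -scalemxAr mulmxBr mulmx1 -scalemxAr mulmxA.
  have xxx : x *m x^T *m x = r ^+ 2 *: x by rewrite xx mul_scalar_mx.
  transitivity ((conf r)^-1 *: (x - defect r *: (r ^+ 2 *: x))).
    by congr (_ *: (_ - _ *: _)); exact: xxx.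
  rewrite scalerA -[X in X - _]scale1r.
  rewrite -scalerBl scalerA -(conf_defect r0) addrK mulVf ?scale1r//.
  exact: conf_neq0.
rewrite /bilin -scalemxAl xI linearZ/= -scalemxAr.
transitivity (((d / r) *: ((d / r) *: (r ^+ 2)%:M) : 'M[R]_1) 0 0).
  congr (fun_of_matrix _ 0 0); congr (_ *: _).
  by rewrite -scalemxAl; congr (_ *: _); exact: xx.
by rewrite !mxE eqxx mulr1n; field; rewrite gt_eqF.
Qed.

Lemma bilin_ge_radial x v : x != 0 ->
  (dot x v / enorm x) ^+ 2 <= bilin (g x) v v.
Proof.
move=> x0; set r := enorm x; have r0 : 0 < r := enorm_gt0 x0.
have rn0 : r != 0 by rewrite gt_eqF.
rewrite (bilin_radial gJ)// -/r expr_div_n expr2 lerDl mulr_ge0//.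
  by rewrite divr_ge0 ?sqr_ge0.
suff -> : dot v v - dot x v * dot x v / r ^+ 2 =
    dot (v - (dot x v / r ^+ 2) *: x) (v - (dot x v / r ^+ 2) *: x).
  exact: dot_ge0.
rewrite !(dotBl, dotBr, dotZl, dotZr) -(sqr_enorm x) -/r (dotC v x).
by field.
Qed.

End RotationallySymmetricCurvature.

Lemma sqrt_det_metric (R : realType) n (g : 'rV[R]_n.+1 -> 'M[R]_n.+1) (J : R -> R)
    (x : 'rV[R]_n.+1) :
  rotationally_symmetric g J -> (forall r : R, 0 < r -> 0 < J r) -> x != 0 ->
  Num.sqrt (\det (g x)) = (J (enorm x) / enorm x) ^+ n.
Proof.
move=> gJ J0 x0; set r := enorm x; have r0 : 0 < r := enorm_gt0 x0.
(* The matrix form of the metric involves no derivative, so it applies with [J] itself in place of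
   the extension [F]. *)
have JJ (s : R) : 0 <= s -> J s = J s by [].
rewrite (metric_mx gJ JJ x0) det_scalar_rank1 ?(conf_neq0 JJ)//.
rewrite -sqr_enorm -/r conf_defect// mulr1 /conf -expr_div_n exprAC sqrtr_sqr.
by rewrite ger0_norm// exprn_ge0// divr_ge0// ltW// J0.
Qed.

(** * Geodesic balls *)

Section MonotoneIntegral.
Local Open Scope ereal_scope.
Context d (T : measurableType d) (R : realType) (mu : {measure set T -> \bar R}).

(* The integral is a difference of suprema over simple functions, so it is
   monotone without measurability; this is what allows comparing with the
   lowest Ricci eigenvalue, whose measurability is never established. *)
Lemma le_integral_nonmeasurable (D1 D2 : set T) (f1 f2 : T -> \bar R) :
  (forall x, (f1 \_ D1) x <= (f2 \_ D2) x) ->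
  \int[mu]_(x in D1) f1 x <= \int[mu]_(x in D2) f2 x.
Proof.
move=> f12; rewrite /integral; apply: leeB.
  apply: ereal_sup_le => _ [h /= hf <-]; exists h => // x.
  apply: le_trans (hf x) _; rewrite !funeposE ge_max !le_max f12 lexx orbT/=.
  by [].
apply: ereal_sup_le => _ [h /= hf <-]; exists h => // x.
apply: le_trans (hf x) _; rewrite !funenegE ge_max !le_max leeN2 f12 lexx orbT/=.
by [].
Qed.

End MonotoneIntegral.

Section GeodesicBall.
Context (R : realType) (n : nat) (g : 'rV[R]_n -> 'M[R]_n) (J : R -> R).
Hypothesis gJ : rotationally_symmetric g J.
Implicit Types (c : R -> 'rV[R]_n).

Let is_derive_curve c (t : R) i : C1_curve c ->
  is_derive t 1 (fun s => c s 0 i) (derive1 c t 0 i).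
Proof.
move=> [dc _]; split; first exact: (derivable_mxP _ _ _).1 (dc t) 0 i.
by rewrite derive1E (derive_mx (dc t)) mxE.
Qed.

Lemma continuous_coord (u : R -> 'rV[R]_n) i :
  continuous u -> continuous (fun t => u t 0 i).
Proof.
move=> cu t; apply: (@continuous_comp _ _ _ u (fun y : 'rV[R]_n => y 0 i)); first exact: cu.
exact: coord_continuous.
Qed.

(** The speed of a curve is at least its radial velocity, by [bilin_ge_radial]. *)
Lemma curve_length_ge c : C1_curve c ->
  ((enorm (c 1) - enorm (c 0))%:E <= curve_length g c)%E.
Proof.
move=> cC1; have [dc cc] := cC1.
pose q t := dot (c t) (c t); pose p t := dot (c t) (derive1 c t).
have dq (t : R) : is_derive t 1 q (2 * p t).
  rewrite /q /p /dot mulr_sumr; apply: is_derive_bigsum => i.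
  apply: is_derive_eq (is_derive_mul (is_derive_curve t i cC1) (is_derive_curve t i cC1)) _.
  by ring.
have cc0 : continuous c by move=> t; apply/differentiable_continuous/derivable1_diffP/dc.
have cdot (u : R -> 'rV[R]_n) : continuous u -> continuous (fun t => dot (c t) (u t)).
  move=> cu; apply: continuous_big => [|i _ t]; first exact: add_continuous.
  by apply: cvgM; apply: continuous_coord.
apply/lee_addgt0Pr => e e0.
(* [enorm \o c] need not be differentiable where the curve meets the origin. *)
pose N t := Num.sqrt (q t + e ^+ 2).
have q0 t : 0 <= q t := dot_ge0 (c t).
have qe0 t : 0 < q t + e ^+ 2 by rewrite ltr_wpDl// exprn_gt0.
have N0 t : 0 < N t by rewrite sqrtr_gt0.
have cN t : enorm (c t) <= N t by apply: ler_wsqrtr; rewrite lerDl sqr_ge0.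
have dN (t : R) : is_derive t 1 N (p t / N t).
  have dqe := is_derive_add (dq t) (is_derive_const (e ^+ 2) t 1).
  apply: is_derive_eq (@is_derive_chain _ _ Num.sqrt (fun t => q t + e ^+ 2) t 1 _ _
    (is_derive1_sqrt (qe0 t)) dqe) _.
  by rewrite -/(N t); field; rewrite gt_eqF.
have cN' : continuous (fun t => p t / N t).
  move=> t; apply: cvgM; first exact: cdot.
  apply: cvgV; first by rewrite gt_eqF.
  by apply/differentiable_continuous/derivable1_diffP; case: (dN t).
have NL : ((N 1 - N 0)%:E <= curve_length g c)%E.
  rewrite -(integral_is_derive ltr01 dN cN').
  apply: le_integral_nonmeasurable => t; rewrite /patch; case: ifP => // _.
  (* Rotational symmetry says nothing about [g] at the origin, but there the derivative of [N]
     vanishes because [p t = 0]. *)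
  rewrite lee_fin; have [c0|ct0] := eqVneq (c t) 0.
    by rewrite /p c0 /dot big1 ?mul0r ?sqrtr_ge0// => i _; rewrite mxE mul0r.
  apply: le_trans (ler_norm _) _; rewrite normrM normfV (gtr0_norm (N0 t)).
  apply: (@le_trans _ _ (`|p t| / enorm (c t))).
    by rewrite ler_wpM2l// lef_pV2 ?posrE ?enorm_gt0.
  rewrite -[X in _ / X](ger0_norm (enorm_ge0 _)) -normfV -normrM -sqrtr_sqr.
  by apply: ler_wsqrtr; exact: (bilin_ge_radial gJ (derive1 c t) ct0).
apply: (@le_trans _ _ ((N 1 - N 0)%:E + e%:E)%E); last by rewrite leeD2r.
rewrite -EFinD lee_fin.
suff : N 0 <= enorm (c 0) + e by have := cN 1; lra.
rewrite -(@ler_pXn2r _ 2)// ?nnegrE ?addr_ge0 ?enorm_ge0 ?(ltW e0) ?(ltW (N0 _))//.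
rewrite sqr_sqrtr ?(ltW (qe0 _))// sqrrD sqr_enorm -/(q 0) lerD2r lerDl.
by rewrite mulrn_wge0// mulr_ge0 ?enorm_ge0 ?ltW.
Qed.

Lemma piecewise_length_ge s (x y : 'rV[R]_n) : piecewise_C1 x s y ->
  ((enorm y - enorm x)%:E <= \sum_(c <- s) curve_length g c)%E.
Proof.
elim: s x => [x ->|c s IHs x [cC1 cx cs]]; first by rewrite big_nil subrr.
rewrite big_cons; apply: le_trans (leeD (curve_length_ge cC1) (IHs _ cs)).
by rewrite -EFinD lee_fin cx; lra.
Qed.

(** For an upper bound on the volume this inclusion suffices, so no minimising curve has to be
    exhibited. *)
Lemma geodesic_ball_subset r : geodesic_ball g 0 r `<=` [set y | enorm y < r].
Proof.
move=> y /= yr; rewrite ltNge; apply/negP => ry.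
move: yr; apply/negP; rewrite -leNgt.
apply: (@le_trans _ _ (enorm y)%:E); first by rewrite lee_fin.
apply: le_ereal_inf_tmp => _ [s /= ys <-].
by have := piecewise_length_ge ys; rewrite enorm0 subr0.
Qed.

End GeodesicBall.

(** * Radial test functions *)

Section SmoothFunctions.
Context (R : realType) (n : nat).
Implicit Types (f h : 'rV[R]_n -> R) (i j : 'I_n).

Lemma Ck_weaken k f : Ck k.+1 f -> Ck k f.
Proof.
elim: k f => [|k IHk] f [cf df]; first by [].
by split=> // i; have [? /IHk] := df i.
Qed.

Lemma Ck_const k (c : R) : Ck k (fun _ : 'rV[R]_n => c).
Proof.
elim: k c => [|k IHk] c; first by split=> //; exact: cst_continuous.
split=> [|i]; first exact: cst_continuous.
split=> [x|]; first exact: derivable_cst.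
rewrite (_ : partial i _ = fun=> 0); first exact: IHk.
by apply/funext => x; rewrite /partial; have [_ ->] := is_derive_const c x (delta_mx 0 i).
Qed.

Lemma Ck_add k f h : Ck k f -> Ck k h -> Ck k (fun x => f x + h x).
Proof.
elim: k f h => [|k IHk] f h [cf df] [ch dh]; first by split=> // x; exact: cvgD (cf x) (ch x).
split=> [x|i]; first exact: cvgD (cf x) (ch x).
have [fi fiC] := df i; have [hi hiC] := dh i.
have D x := is_derive_add (derivableP (fi x)) (derivableP (hi x)).
split=> [x|]; first by case: (D x).
rewrite (_ : partial i _ = fun x => partial i f x + partial i h x); first exact: IHk.
by apply/funext => x; case: (D x).
Qed.

Lemma Ck_mul k f h : Ck k f -> Ck k h -> Ck k (fun x => f x * h x).
Proof.
elim: k f h => [|k IHk] f h fk hk.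
  by have [cf _] := fk; have [ch _] := hk; split=> // x; exact: cvgM (cf x) (ch x).
have [cf df] := fk; have [ch dh] := hk.
split=> [x|i]; first exact: cvgM (cf x) (ch x).
have [fi fiC] := df i; have [hi hiC] := dh i.
have D x := is_derive_mul (derivableP (fi x)) (derivableP (hi x)).
split=> [x|]; first by case: (D x).
rewrite (_ : partial i _ = fun x => partial i f x * h x + f x * partial i h x).
  by apply: Ck_add; apply: IHk => //; exact: Ck_weaken.
by apply/funext => x; case: (D x).
Qed.

Lemma Ck_coord k i : Ck k (fun x : 'rV[R]_n => x 0 i).
Proof.
have c0 : continuous (fun x : 'rV[R]_n => x 0 i) by exact: coord_continuous.
case: k => [|k]; first by split.
split=> // j; split=> [x|]; first by case: (is_derive_coord x (delta_mx 0 j) i).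
rewrite (_ : partial j _ = fun=> (delta_mx 0 j : 'rV[R]_n) 0 i); first exact: Ck_const.
by apply/funext => x; case: (is_derive_coord x (delta_mx 0 j) i).
Qed.

Lemma Ck_sum k m (f : 'I_m -> 'rV[R]_n -> R) :
  (forall a, Ck k (f a)) -> Ck k (fun x => \sum_a f a x).
Proof.
elim: m f => [|m IHm] f fk.
  by under eq_fun do rewrite big_ord0; exact: Ck_const.
under eq_fun do rewrite big_ord_recl.
by apply: Ck_add => //; exact: IHm.
Qed.

(* Smoothness of [h] on [D] is expressed by a family [S] containing [h] and
   closed under differentiation on [D]. *)
Lemma smooth_comp (S : set (R -> R)) (D : set R) f :
  (forall h : R -> R, S h -> exists2 h', S h' & forall u : R, D u -> is_derive u 1 h (h' u)) ->
  (forall x, D (f x)) -> smooth f -> forall h : R -> R, S h -> smooth (fun x => h (f x)).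
Proof.
move=> SD Df fsm h Sh k; elim: k h Sh => [|k IHk] h Sh.
  have [h' _ dh] := SD _ Sh; split=> // x.
  apply: (@continuous_comp _ _ _ f h); first by have [cf _] := fsm 0%N; exact: cf.
  by apply/differentiable_continuous/derivable1_diffP; case: (dh _ (Df x)).
have [h' Sh' dh] := SD _ Sh; have [cf _] := fsm 0%N.
split=> [x|i].
  apply: (@continuous_comp _ _ _ f h); first exact: cf.
  by apply/differentiable_continuous/derivable1_diffP; case: (dh _ (Df x)).
have [_ /(_ i)[fi fiC]] := fsm k.+1.
have E x := is_derive_chain (dh _ (Df x)) (derivableP (fi x)).
split=> [x|]; first by case: (E x).
rewrite (_ : partial i _ = fun x => h' (f x) * partial i f x).
  by apply: Ck_mul => //; exact: IHk.
by apply/funext => x; case: (E x).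
Qed.

(** The multiples of [sqrt u / u^m] form a family closed under differentiation on the positive
    half-line. *)
Lemma smooth_sqrt f : smooth f -> (forall x, 0 < f x) ->
  smooth (fun x => Num.sqrt (f x)).
Proof.
move=> fsm f0.
pose S := [set h : R -> R | exists c m, h = fun u => c * (Num.sqrt u * (u ^+ m)^-1)].
have SD (h : R -> R) : S h -> exists2 h', S h' & forall u : R, 0 < u -> is_derive u 1 h (h' u).
  move=> [c [m ->]]; exists (fun u => c * (2^-1 - m%:R) * (Num.sqrt u * (u ^+ m.+1)^-1)).
    by exists (c * (2^-1 - m%:R)), m.+1.
  move=> u u0; have um0 : u ^+ m != 0 by rewrite expf_neq0// gt_eqF.
  have su0 : Num.sqrt u != 0 by rewrite gt_eqF// sqrtr_gt0.
  apply: is_derive_eq (is_derive_mul (is_derive_const c u 1)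
    (is_derive_mul (is_derive1_sqrt u0) (@is_derive_inv _ _ (fun s : R => s ^+ m) _ _ _ um0
      (@is_derive_pow _ _ id m u 1 1 (is_derive_id u 1))))) _.
  have -> : (2 * Num.sqrt u)^-1 = Num.sqrt u / (2 * u).
    by rewrite -[X in _ / (2 * X)]sqr_sqrtr ?ltW//; field.
  move: (Num.sqrt u) => s; rewrite (exprS u m); have un0 : u != 0 by rewrite gt_eqF.
  case: m um0 => [_|m]; first by rewrite !expr0 /=; field.
  rewrite [m.+1.-1]/= !(exprS u m) mulf_eq0 negb_or => /andP[_].
  by move: (u ^+ m) => P P0; field; rewrite P0.
rewrite (_ : (fun x => _) = fun x => 1 * (Num.sqrt (f x) * (f x ^+ 0)^-1)).
  apply: (@smooth_comp S [set u | 0 < u] f SD f0 fsm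
    (fun u => 1 * (Num.sqrt u * (u ^+ 0)^-1))).
  by exists 1, 0%N.
by apply/funext => x; rewrite expr0 invr1 mulr1 mul1r.
Qed.

Lemma smooth_dot : smooth (fun x : 'rV[R]_n => dot x x).
Proof. by move=> k; apply: Ck_sum => i; apply: Ck_mul; exact: Ck_coord. Qed.

End SmoothFunctions.

Section FlatFunction.
Context (R : realType) (a : R).
Hypothesis a_gt0 : 0 < a.

(** The classical flat function [exp (- a / t)], extended by 0; the polynomial in [1 / t] makes the
    family closed under differentiation, so that it contains all derivatives. *)
Definition flat (p : {poly R}) (t : R) : R :=
  if 0 < t then p.[t^-1] * expR (- (a / t)) else 0.

(** Take [z <= exp z] at [z = a y / (i + 1)] to the power [i], then use
    [exp (i z) <= exp ((i + 1) z)]. Dividing by [i + 1] instead of [i] covers [i = 0]. *)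
Lemma monomial_le_expR i (y : R) : 0 <= y ->
  y ^+ i <= (i.+1%:R / a) ^+ i * expR (a * y).
Proof.
move=> y0; set m := i.+1%:R; have m0 : 0 < m by rewrite ltr0n.
have -> : y ^+ i = (m / a) ^+ i * (a * y / m) ^+ i.
  by rewrite -exprMn; congr (_ ^+ _); field; rewrite !gt_eqF.
apply: ler_wpM2l; first by rewrite exprn_ge0// divr_ge0// ltW.
have z0 : 0 <= a * y / m by rewrite divr_ge0 ?mulr_ge0 ?(ltW a_gt0) ?(ltW m0).
have -> : expR (a * y) = expR (a * y / m) ^+ i.+1.
  by rewrite -expRM_natl; congr expR; rewrite -/m; field; rewrite gt_eqF.
have le1 : a * y / m <= expR (a * y / m).
  by apply: le_trans (expR_ge1Dx _); rewrite lerDr.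
have ge1 : 1 <= expR (a * y / m) by rewrite -expR0 ler_expR.
apply: (@le_trans _ _ (expR (a * y / m) ^+ i)); first by rewrite lerXn2r ?nnegrE// (le_trans z0).
by rewrite ler_weXn2l.
Qed.

Lemma flat_bounded p : exists2 C, 0 <= C & forall t, `|flat p t| <= C.
Proof.
exists (\sum_(i < size p) `|p`_i| * (i.+1%:R / a) ^+ i).
  by apply: sumr_ge0 => i _; rewrite mulr_ge0// exprn_ge0// divr_ge0// ltW.
move=> t; rewrite /flat; case: ifPn => t0; last first.
  by rewrite normr0; apply: sumr_ge0 => i _; rewrite mulr_ge0// exprn_ge0// divr_ge0// ltW.
rewrite horner_coef mulr_suml (le_trans (ler_norm_sum _ _ _))// ler_sum// => i _.
have ti0 : 0 <= t^-1 by rewrite invr_ge0 ltW.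
rewrite !normrM -mulrA ler_wpM2l// normrX (ger0_norm ti0) (ger0_norm (expR_ge0 _)).
by rewrite expRN ler_pdivrMr ?expR_gt0// monomial_le_expR.
Qed.

Lemma is_derive_quadratic0 (f : R -> R) C : f 0 = 0 ->
  (forall t, `|f t| <= C * t ^+ 2) -> is_derive (0 : R) 1 f 0.
Proof.
move=> f0 fC.
have C0 : 0 <= C by have := le_trans (normr_ge0 _) (fC 1); rewrite expr1n mulr1.
have lim0 : h^-1 *: ((f \o shift 0) (h *: (1 : R)) - f 0) @[h --> 0^'] --> (0 : R).
  apply/cvgrPdist_le => e e0; near=> h.
  have h0 : h != 0 by near: h; exact: nbhs_dnbhs_neq.
  rewrite /= f0 subr0 addr0 sub0r normrN [h *: 1]mulr1 normrM normfV.
  rewrite mulrC ler_pdivrMr ?normr_gt0//; apply: le_trans (fC h) _.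
  rewrite -real_normK ?num_real// expr2 mulrA ler_wpM2r//.
  apply: (@le_trans _ _ ((C + 1) * `|h|)); first by rewrite ler_wpM2r// lerDl.
  rewrite mulrC -ler_pdivlMr ?ltr_wpDl//.
  by near: h; apply: dnbhs0_le; rewrite divr_gt0// ltr_wpDl.
by split; [apply/cvg_ex; exists 0|exact/cvg_lim].
Unshelve. all: by end_near. Qed.

Definition flat_step (p : {poly R}) : {poly R} := 'X^2 * (a *: p - p^`()).

Lemma is_derive_flat p (t : R) : is_derive t 1 (flat p) (flat (flat_step p) t).
Proof.
have [t0|t0|->] := ltgtP t 0.
- have fE : \forall s \near t, (fun=> 0) s = flat p s.
    near=> s; rewrite /flat ltNge (_ : s <= 0)//.
    by apply: ltW; near: s; exact: lt_nbhsl.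
  rewrite /flat ltNge (ltW t0)/=.
  exact: near_eq_is_derive fE (is_derive_const 0 t 1).
- have t_neq0 : t != 0 by rewrite gt_eqF.
  have fE : \forall s \near t, p.[s^-1] * expR (- (a / s)) = flat p s.
    near=> s; rewrite /flat (_ : 0 < s)//.
    by near: s; exact: lt_nbhsr.
  have dinv := @is_derive_inv _ _ id t 1 1 t_neq0 (is_derive_id t 1).
  have dp := @is_derive_chain _ _ (horner p) _ t 1 _ _ (is_derive_poly p t^-1) dinv.
  have de := @is_derive_chain _ _ expR (fun s : R => (- a) * s^-1) t 1 _ _
    (is_derive_expR _) (is_derive_mul (is_derive_const (- a) t 1) dinv).
  have fE' : \forall s \near t, p.[s^-1] * expR (- a * s^-1) = flat p s.
    by apply: filterS fE => s <-; rewrite mulNr.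
  apply: is_derive_eq (near_eq_is_derive fE' (is_derive_mul dp de)) _.
  rewrite /flat t0 /flat_step hornerM hornerXn hornerD hornerN hornerZ (mulNr a t^-1).
  by move: (expR _) (p.[_]) (p^`().[_]) => E P P'; field.
(* At 0, [flat p t = t^2 * flat ('X^2 * p) t] with a bounded second factor, so [flat p] is
   quadratically small. *)
- have [C C0 fC] := flat_bounded ('X^2 * p).
  rewrite [X in is_derive _ _ _ X]/flat ltxx.
  apply: (@is_derive_quadratic0 _ C); first by rewrite /flat ltxx.
  move=> {}t; have [->|tn0] := eqVneq t 0.
    by rewrite /flat ltxx normr0 mulr_ge0// sqr_ge0.
  rewrite -ler_pdivrMr ?exprn_even_gt0//.
  have flatE : flat ('X^2 * p) t = flat p t / t ^+ 2.
    rewrite /flat; case: ifP => _; last by rewrite mul0r.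
    by rewrite hornerM hornerXn exprVn -mulrA mulrC.
  apply: le_trans (fC t).
  by rewrite flatE normrM normfV [`|t ^+ 2|]ger0_norm ?sqr_ge0.
Unshelve. all: by end_near. Qed.

Lemma smooth_flat n (f : 'rV[R]_n -> R) : smooth f -> smooth (fun x => flat 1 (f x)).
Proof.
move=> fsm.
apply: (@smooth_comp _ _ (range flat) setT f) => //.
move=> h [p _ <-]; exists (flat (flat_step p)); first by exists (flat_step p).
by move=> u _; exact: is_derive_flat.
Qed.

End FlatFunction.

(** * The bump with a smoothed tip *)

Section BumpProfile.
Context (R : realType) (a rho e : R).
Hypotheses (a_gt0 : 0 < a) (rho_gt0 : 0 < rho) (e_gt0 : 0 < e).
Implicit Types r : R.

Definition smoothed_radius r := Num.sqrt (r ^+ 2 + e ^+ 2).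
Local Notation s := smoothed_radius.

Lemma smoothed_radius_gt0 r : 0 < s r.
Proof. by rewrite sqrtr_gt0 ltr_wpDl ?sqr_ge0 ?exprn_gt0. Qed.

Lemma sqr_smoothed_radius r : s r ^+ 2 = r ^+ 2 + e ^+ 2.
Proof. by rewrite sqr_sqrtr// addr_ge0 ?sqr_ge0. Qed.

Lemma le_smoothed_radius r : r <= s r.
Proof.
apply: le_trans (ler_norm r) _; rewrite -sqrtr_sqr.
by apply: ler_wsqrtr; rewrite lerDl sqr_ge0.
Qed.

Lemma smoothed_radius_le r : 0 <= r -> s r <= r + e.
Proof.
move=> r0; have re0 : 0 <= r + e by rewrite addr_ge0// ltW.
rewrite -[leRHS](ger0_norm re0) -sqrtr_sqr; apply: ler_wsqrtr.
by rewrite sqrrD -addrA lerD2l lerDr mulrn_wge0// mulr_ge0// ltW.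
Qed.

Lemma is_derive_smoothed_radius r : is_derive r 1 s (r / s r).
Proof.
have q0 : 0 < r ^+ 2 + e ^+ 2 by rewrite ltr_wpDl ?sqr_ge0 ?exprn_gt0.
apply: is_derive_eq (@is_derive_chain _ _ Num.sqrt (fun r : R => r ^+ 2 + e ^+ 2) r 1 _ _
  (is_derive1_sqrt q0) (is_derive_add (@is_derive_pow _ _ id 2 r 1 1 (is_derive_id r 1))
    (is_derive_const (e ^+ 2) r 1))) _.
rewrite -/(s r) /= expr1 mulr1 addr0; field; rewrite gt_eqF//.
exact: smoothed_radius_gt0.
Qed.

Definition height r := 1 - s r / rho.

Let is_derive_height r : is_derive r 1 height (- (r / s r / rho)).
Proof.
apply: is_derive_eq (is_derive_sub (is_derive_const 1 r 1)
  (is_derive_mul (is_derive_smoothed_radius r) (is_derive_const rho^-1 r 1))) _.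
by rewrite mulr0 addr0 sub0r.
Qed.

Definition profile r := flat a 1 (height r).
Definition profile1 r := - (flat a (flat_step a 1) (height r) * (r / s r / rho)).
Definition profile2 r :=
  flat a (flat_step a (flat_step a 1)) (height r) * (r / s r / rho) ^+ 2 -
  flat a (flat_step a 1) (height r) * (e ^+ 2 / s r ^+ 3 / rho).

Lemma is_derive_profile r : is_derive r 1 profile (profile1 r).
Proof.
apply: is_derive_eq (@is_derive_chain _ _ (flat a 1) height r 1 _ _
  (is_derive_flat a_gt0 1 _) (is_derive_height r)) _.
by rewrite mulrN.
Qed.

Lemma is_derive_profile1 r : is_derive r 1 profile1 (profile2 r).
Proof.
have s0 : s r != 0 by rewrite gt_eqF// smoothed_radius_gt0.
have df := @is_derive_chain _ _ (flat a (flat_step a 1)) height r 1 _ _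
  (is_derive_flat a_gt0 _ _) (is_derive_height r).
have dq := is_derive_mul (is_derive_mul (is_derive_id r 1)
  (is_derive_inv s0 (is_derive_smoothed_radius r))) (is_derive_const rho^-1 r 1).
have dm := is_derive_sub (is_derive_const 0 r 1) (is_derive_mul df dq).
have E : (fun y : R => 0 - flat a (flat_step a 1) (height y) * (id y / s y / rho)) = profile1.
  by apply/funext => y; rewrite sub0r.
rewrite -E; apply: is_derive_eq dm _.
rewrite /profile2; have -> : e ^+ 2 = s r ^+ 2 - r ^+ 2.
  by rewrite sqr_smoothed_radius addrAC subrr add0r.
by rewrite /=; field; rewrite gt_eqF ?s0.
Qed.

Lemma continuous_profile2 : continuous profile2.
Proof.
have ch : continuous height.
  by move=> r; apply/differentiable_continuous/derivable1_diffP; case: (is_derive_height r).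
have cs : continuous s.
  move=> r; apply/differentiable_continuous/derivable1_diffP.
  by case: (is_derive_smoothed_radius r).
have cflat p : continuous (fun r => flat a p (height r)).
  move=> r; apply: (@continuous_comp _ _ _ height (flat a p)); first exact: ch.
  by apply/differentiable_continuous/derivable1_diffP; case: (is_derive_flat a_gt0 p (height r)).
have cV k : continuous (fun r => (s r ^+ k)^-1).
  move=> r; apply: cvgV; first by rewrite expf_neq0// gt_eqF// smoothed_radius_gt0.
  by apply: (@continuous_comp _ _ _ s (fun x : R => x ^+ k)); [exact: cs|exact: exprn_continuous].
move=> r; apply: cvgB.
  apply: cvgM; first exact: cflat.
  apply: (@continuous_comp _ _ _ (fun r => r / s r / rho) (fun x : R => x ^+ 2)).
    apply: cvgM; last exact: cvg_cst.
    apply: cvgM; first exact: cvg_id.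
    by apply: cvgV; [rewrite gt_eqF// smoothed_radius_gt0|exact: cs].
  exact: exprn_continuous.
apply: cvgM; first exact: cflat.
apply: cvgM; last exact: cvg_cst.
by apply: cvgM; [exact: cvg_cst|exact: cV].
Qed.

Lemma flat1_values t : 0 < t -> [/\ flat a 1 t = expR (- (a / t)),
  flat a (flat_step a 1) t = a / t ^+ 2 * expR (- (a / t)) &
  flat a (flat_step a (flat_step a 1)) t =
    (a ^+ 2 / t ^+ 4 - 2 * a / t ^+ 3) * expR (- (a / t))].
Proof.
move=> t0; have tn0 : t != 0 by rewrite gt_eqF.
have q1 : flat_step a 1 = 'X^2 * a%:P.
  by rewrite /flat_step derivC subr0 alg_polyC.
have q2 : flat_step a (flat_step a 1) = 'X^2 * (a%:P * ('X^2 * a%:P) - 'X *+ 2 * a%:P).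
  rewrite [LHS]/flat_step q1 derivM derivXn derivC mulr0 addr0 /= expr1.
  by rewrite mul_polyC.
rewrite q2 q1 /flat t0; split; first by rewrite hornerC mul1r.
  by rewrite hornerM hornerXn hornerC; field.
by rewrite !(hornerXn, hornerMn, hornerX, hornerC, hornerD, hornerN, hornerM) -mulr_natl; field.
Qed.

Lemma profile_eq0 r : rho <= s r ->
  [/\ profile r = 0, profile1 r = 0 & profile2 r = 0].
Proof.
move=> rs; have h0 : height r <= 0 by rewrite subr_le0 ler_pdivlMr// mul1r.
by rewrite /profile /profile1 /profile2 /flat ltNge h0 /= !mul0r subr0 oppr0.
Qed.

Lemma profile_ge0 r : 0 <= profile r.
Proof.
rewrite /profile; have [h0|h0] := ltP 0 (height r); last by rewrite /flat ltNge h0.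
by have [-> _ _] := flat1_values h0; exact: expR_ge0.
Qed.

Lemma profile_le1 r : profile r <= 1.
Proof.
rewrite /profile; have [h0|h0] := ltP 0 (height r); last by rewrite /flat ltNge h0.
have [-> _ _] := flat1_values h0.
by rewrite -expR0 ler_expR oppr_le0 divr_ge0// ltW.
Qed.

(** Here [smoothed_radius] is at most [rho / 2 + rho / 4], so the height is at least [1 / 4]. *)
Lemma profile_ge r : 0 <= r -> r <= rho / 2 -> e <= rho / 4 ->
  expR (- (4 * a)) <= profile r.
Proof.
move=> r0 r2 e4; have sr := smoothed_radius_le r0.
have h4 : 4^-1 <= height r.
  rewrite /height lerBrDr -lerBrDl ler_pdivrMr//.
  by apply: le_trans sr _; move: r2 e4; lra.
have h0 : 0 < height r by apply: lt_le_trans h4; rewrite invr_gt0.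
rewrite /profile; have [-> _ _] := flat1_values h0.
rewrite ler_expR lerN2 [leLHS]mulrC; apply: ler_wpM2r; first exact: ltW.
by rewrite -[leRHS]invrK lef_pV2// posrE invr_gt0.
Qed.

Lemma test_function_profile n : test_function (fun x : 'rV[R]_n => profile (enorm x)).
Proof.
split.
  rewrite (_ : (fun x => _) =
    fun x => flat a 1 (1 + - rho^-1 * Num.sqrt (dot x x + e ^+ 2))); last first.
    by apply/funext => x; rewrite /profile /height /s sqr_enorm mulNr [_^-1 * _]mulrC.
  apply: (smooth_flat a_gt0) => k; apply: Ck_add; first exact: Ck_const.
  apply: Ck_mul; first exact: Ck_const.
  apply: smooth_sqrt => [j|x]; last by rewrite ltr_wpDl ?dot_ge0 ?exprn_gt0.
  by apply: Ck_add; [exact: smooth_dot|exact: Ck_const].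
(* Each coordinate is bounded by the Euclidean norm, and the bump vanishes once [smoothed_radius]
   reaches [rho]. *)
pose box := [set x : 'rV[R]_n | forall i, (x ord0 i) \in `[- rho, rho]].
have cbox : compact box.
  by apply: (@rV_compact R n (fun=> [set` `[- rho, rho]])) => _; exact: segment_compact.
apply: (subclosed_compact _ cbox); first exact: closed_closure.
rewrite closureE; apply: smallest_sub.
  by apply: compact_closed cbox; exact: norm_hausdorff.
move=> x /= px i; rewrite in_itv/= -ler_norml.
apply: (@le_trans _ _ (enorm x)).
  rewrite /enorm -sqrtr_sqr; apply: ler_wsqrtr.
  rewrite /dot (bigD1 i)//= -expr2 lerDl.
  by apply: sumr_ge0 => j _; rewrite -expr2 sqr_ge0.
apply: le_trans (le_smoothed_radius _) _; rewrite leNgt; apply: contra px.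
by move=> /ltW /profile_eq0[-> _ _].
Qed.

End BumpProfile.

(** * The one-dimensional inequality *)

Section RadialInequality.
Context (R : realType) (m : nat) (lambda : R) (F F1 F2 : R -> R).
Implicit Types r rho e : R.
Hypothesis lambda_gt : m.+1%:R / 4 < lambda.
Hypothesis dF : forall r, is_derive r 1 F (F1 r).
Hypothesis dF1 : forall r, is_derive r 1 F1 (F2 r).
Hypothesis cF2 : continuous F2.
Hypothesis F_0 : F 0 = 0.
Hypothesis F1_0 : F1 0 = 1.
Hypothesis F_gt0 : forall r, 0 < r -> 0 < F r.

Let continuous_derive (f f' : R -> R) :
  (forall r, is_derive r 1 f (f' r)) -> continuous f.
Proof.
by move=> df r; apply/differentiable_continuous/derivable1_diffP; case: (df r).
Qed.

Let cM (f h : R -> R) : continuous f -> continuous h -> continuous (fun r => f r * h r).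
Proof. by move=> cf ch r; exact: cvgM (cf r) (ch r). Qed.

Let cD (f h : R -> R) : continuous f -> continuous h -> continuous (fun r => f r + h r).
Proof. by move=> cf ch r; exact: cvgD (cf r) (ch r). Qed.

Let cX k (f : R -> R) : continuous f -> continuous (fun r => f r ^+ k).
Proof.
by move=> cf r; apply: (@continuous_comp _ _ _ f (fun x : R => x ^+ k));
  [exact: cf|exact: exprn_continuous].
Qed.

Let cN (f : R -> R) : continuous f -> continuous (fun r => - f r).
Proof. by move=> cf r; apply: cvgN; exact: cf. Qed.

Let cC (c : R) : continuous (fun _ : R => c).
Proof. by move=> r; exact: cvg_cst. Qed.

Let cF : continuous F. Proof. exact: continuous_derive dF. Qed.
Let cF1 : continuous F1. Proof. exact: continuous_derive dF1. Qed.

Local Ltac cont := repeat lazymatch goal with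
  | |- continuous (fun _ => ?c) => exact: (cC c)
  | |- continuous (fun r => @?f r + @?h r) => refine (@cD f h _ _)
  | |- continuous (fun r => @?f r * @?h r) => refine (@cM f h _ _)
  | |- continuous (fun r => @?f r ^+ ?k) => refine (@cX k f _)
  | |- continuous (fun r => - @?f r) => refine (@cN f _)
  | |- continuous (fun r => ?f r) => assumption
  end.

Let F_ge0 r : 0 <= r -> 0 <= F r.
Proof. by rewrite le_eqVlt => /predU1P[<-|/F_gt0/ltW//]; rewrite F_0. Qed.

(** Chosen so that [kappa * m.+1 = 2 * lambda]: this cancels the mixed terms [F1 F^m phi phi'] in
    the second integration by parts. Throughout, [m = n - 2]. *)
Definition kappa := 2 * lambda / m.+1%:R.

Let m1_gt0 : 0 < m.+1%:R :> R. Proof. by rewrite ltr0n. Qed.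

Lemma lambda_gt0 : 0 < lambda.
Proof. by apply: lt_trans lambda_gt; rewrite divr_gt0. Qed.

Lemma kappa_gt : 0 < 2 * kappa - 1.
Proof.
rewrite /kappa subr_gt0 mulrA ltr_pdivlMr// mul1r.
by have := lambda_gt; rewrite ltr_pdivrMr//; lra.
Qed.

Let kappaM : kappa * m.+1%:R = 2 * lambda.
Proof. by rewrite /kappa mulfVK// gt_eqF. Qed.

(* Large enough for [bump_gain]. *)
Definition bump_scale := (2 * kappa + lambda * m%:R + 1) / (2 * kappa - 1) + 1.
Local Notation a := bump_scale.

Let kappa_gt0 : 0 < kappa. Proof. by have := kappa_gt; lra. Qed.
Let lm_ge0 : 0 <= lambda * m%:R. Proof. by rewrite mulr_ge0// ltW// lambda_gt0. Qed.

Lemma bump_scale_ge1 : 1 <= a.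
Proof.
rewrite lerDr divr_ge0 ?(ltW kappa_gt)//.
by move: kappa_gt0 lm_ge0; lra.
Qed.

Let a_gt0 : 0 < a. Proof. exact: lt_le_trans ltr01 bump_scale_ge1. Qed.

Lemma bump_scaleP : lambda * m%:R + 1 <= (2 * kappa - 1) * a - 2 * kappa.
Proof.
rewrite /bump_scale mulrDr mulrCA divff ?gt_eqF ?kappa_gt// !mulr1.
by have := kappa_gt; lra.
Qed.

(** With [y] the inverse of the height, the right-hand side is the bracket
    [kappa phi phi'' + (kappa - 1) phi'^2] of the exact cone, in units of [phi^2 / rho^2]. *)
Lemma bump_gain y : 1 <= y ->
  lambda * m%:R + 1 <= a * y ^+ 3 * ((2 * kappa - 1) * a * y - 2 * kappa).
Proof.
move=> y1; have y0 : 0 <= y by lra.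
have ay : 1 <= a * y ^+ 3 by rewrite mulr_ege1 ?bump_scale_ge1// exprn_ege1.
have inner : lambda * m%:R + 1 <= (2 * kappa - 1) * a * y - 2 * kappa.
  apply: le_trans bump_scaleP _; rewrite lerD2r ler_peMr//.
  by rewrite mulr_ge0 ?(ltW kappa_gt) ?(ltW a_gt0).
apply: (le_trans inner); rewrite ler_peMl//.
by apply: le_trans inner; move: lm_ge0; lra.
Qed.

Section FixedRadius.
Variable rho : R.
Hypothesis rho_gt0 : 0 < rho.

(** The part [lambda * m] pays for the term absorbed through [pow_young]; the remaining 1 controls
    the volume. *)
Let c0 := lambda * m%:R + 1.
Let c0_ge0 : 0 <= c0. Proof. by rewrite addr_ge0. Qed.

(** Smoothing costs twice: [s'' = e^2 / s^3] enters [phi''], and the gain is multiplied by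
    [s'^2 = 1 - e^2 / s^2] only. Both losses are multiples of [e^2 / (s^3 rho)], with a factor [M]
    independent of [e]. *)
Lemma profile_form_le : exists2 M, 0 <= M & forall e r, 0 < e ->
  (1 - kappa) * profile1 a rho e r ^+ 2 - kappa * (profile a rho e r * profile2 a rho e r) <=
  - (c0 * profile a rho e r ^+ 2 / rho ^+ 2) +
  M * (e ^+ 2 / smoothed_radius e r ^+ 3 / rho).
Proof.
(* [flat a 'X] is [exp (- a / h) / h], whose square multiplies the error from [s'']. *)
have [C1 C10 flatC] := flat_bounded a_gt0 'X.
exists (c0 + kappa * a * C1 ^+ 2).
  by rewrite addr_ge0// mulr_ge0 ?sqr_ge0// mulr_ge0// ltW.
move=> e r e0; set s := smoothed_radius e r.
have s0 : 0 < s := smoothed_radius_gt0 e0 r.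
have err0 : 0 <= e ^+ 2 / s ^+ 3 / rho.
  by rewrite !divr_ge0 ?exprn_ge0 ?ltW.
have M0 : 0 <= c0 + kappa * a * C1 ^+ 2.
  by rewrite addr_ge0// mulr_ge0 ?sqr_ge0// mulr_ge0// ltW.
have [rs|sr] := leP rho s.
  have [-> -> ->] := profile_eq0 a rho_gt0 rs.
  by rewrite expr0n/= !(mulr0, mul0r, subr0, oppr0, add0r) mulr_ge0.
pose h := height rho e r; have h0 : 0 < h.
  by rewrite subr_gt0 ltr_pdivrMr// mul1r.
have h1 : h <= 1 by rewrite gerBl divr_ge0 ?ltW.
rewrite /profile /profile1 /profile2 -/h -/s.
have [-> -> ->] := flat1_values a h0.
pose y := h^-1; have y1 : 1 <= y by rewrite invf_ge1.
set E := expR _; have E0 : 0 <= E by exact: expR_ge0.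
have E1 : E <= 1 by rewrite -expR0 ler_expR oppr_le0 divr_ge0 ?ltW.
have yE : (y * E) ^+ 2 <= C1 ^+ 2.
  rewrite lerXn2r ?nnegrE ?mulr_ge0 ?(le_trans _ y1)//.
  apply: le_trans (flatC h); rewrite /flat h0 hornerX.
  exact: ler_norm.
pose q2 := 1 - e ^+ 2 / s ^+ 2.
have q2E : (r / s) ^+ 2 = q2.
  rewrite /q2; have -> : e ^+ 2 = s ^+ 2 - r ^+ 2.
    by rewrite /s sqr_smoothed_radius addrAC subrr add0r.
  by field; rewrite gt_eqF.
pose X := E ^+ 2 * q2 / rho ^+ 2.
have -> : (1 - kappa) * (- (a / h ^+ 2 * E * (r / s / rho))) ^+ 2 -
    kappa * (E * ((a ^+ 2 / h ^+ 4 - 2 * a / h ^+ 3) * E * (r / s / rho) ^+ 2 -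
      a / h ^+ 2 * E * (e ^+ 2 / s ^+ 3 / rho))) =
  - (X * (a * y ^+ 3 * ((2 * kappa - 1) * a * y - 2 * kappa))) +
  kappa * a * (y * E) ^+ 2 * (e ^+ 2 / s ^+ 3 / rho).
  by rewrite /X -q2E /y; field; rewrite !gt_eqF.
have X0 : 0 <= X.
  by rewrite /X -q2E -exprMn divr_ge0 ?sqr_ge0.
have XE : c0 * E ^+ 2 / rho ^+ 2 - c0 * (e ^+ 2 / s ^+ 3 / rho) <= X * c0.
  have -> : X * c0 = c0 * E ^+ 2 / rho ^+ 2 - c0 * (E ^+ 2 * (e ^+ 2 / s ^+ 2 / rho ^+ 2)).
    by rewrite /X /q2; field; rewrite !gt_eqF.
  rewrite lerD2l lerN2 ler_wpM2l//.
  apply: (@le_trans _ _ (e ^+ 2 / s ^+ 2 / rho ^+ 2)).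
    rewrite ler_piMl ?exprn_ile1//.
    by rewrite !divr_ge0 ?exprn_ge0 ?ltW.
  (* Since [s < rho], one factor [1 / rho] may be replaced by [1 / s]. *)
  have -> : e ^+ 2 / s ^+ 2 / rho ^+ 2 = e ^+ 2 / s ^+ 2 / rho * rho^-1.
    by field; rewrite !gt_eqF.
  have -> : e ^+ 2 / s ^+ 3 / rho = e ^+ 2 / s ^+ 2 / rho * s^-1.
    by field; rewrite !gt_eqF.
  apply: ler_wpM2l; first by rewrite !divr_ge0 ?exprn_ge0 ?ltW.
  by rewrite lef_pV2 ?posrE// ltW.
have Xgain : X * c0 <= X * (a * y ^+ 3 * ((2 * kappa - 1) * a * y - 2 * kappa)).
  by apply: ler_wpM2l => //; exact: bump_gain.
have last_le : kappa * a * (y * E) ^+ 2 * (e ^+ 2 / s ^+ 3 / rho) <=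
    kappa * a * C1 ^+ 2 * (e ^+ 2 / s ^+ 3 / rho).
  apply: ler_wpM2r => //; apply: ler_wpM2l => //.
  by rewrite mulr_ge0 ?(ltW a_gt0) ?(ltW kappa_gt0).
rewrite [X in _ <= _ + X]mulrDl addrA; apply: lerD last_le.
apply: (@le_trans _ _ (- (X * c0))); first by rewrite lerN2.
by rewrite lerNl opprD opprK.
Qed.

(** Mean value theorem from [F 0 = 0]. The factor [r] tames the smoothing error near the tip; [B]
    may depend on the metric. *)
Lemma pow_F_le : exists2 B, 0 <= B &
  forall r, 0 <= r -> r <= rho -> F r ^+ m.+1 <= B * r.
Proof.
pose H' r := m.+1%:R * F r ^+ m * F1 r.
have dH r : is_derive r 1 (fun r => F r ^+ m.+1) (H' r) by exact: is_derive_pow.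
have cH' : continuous H' by apply: cM => //; apply: cM; [exact: cC|exact: cX].
have [c _ cmax] := EVT_max (ltW rho_gt0) (continuous_subspaceT cH').
exists (Num.max 0 (H' c)) => [|r r0 rr]; first by rewrite le_max lexx.
have [->|rn0] := eqVneq r 0; first by rewrite F_0 expr0n/= mulr0.
have r_gt0 : 0 < r by rewrite lt_neqAle eq_sym rn0.
have cH := continuous_derive dH.
have [d /[!in_itv]/= /andP[d0 dr]] := MVT r_gt0 (fun x _ => dH x) (continuous_subspaceT cH).
rewrite F_0 expr0n/= !subr0 => ->.
apply: ler_wpM2r => //; rewrite le_max; apply/orP; right; apply: cmax.
by rewrite in_itv/= (ltW d0) (le_trans (ltW dr)).
Qed.

(** The factor [F^m.+1] is multiplied into the curvature to clear the denominators, which makes the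
    form continuous at 0. For [m = 0] the truncated exponent [m.-1] comes with the coefficient 0. *)
Definition ricci_form e r :=
  profile1 a rho e r ^+ 2 * F r ^+ m.+1 +
  lambda * profile a rho e r ^+ 2 *
    (- F2 r * F r ^+ m + m%:R * (1 - F1 r ^+ 2) * F r ^+ m.-1).

Lemma continuous_ricci_form e : 0 < e -> continuous (ricci_form e).
Proof.
move=> e0; have cp := continuous_derive (fun r => is_derive_profile rho a_gt0 e0 r).
have cp1 := continuous_derive (fun r => is_derive_profile1 a_gt0 rho_gt0 e0 r).
by rewrite /ricci_form; cont.
Qed.

(** The boundary terms of both integrations by parts, gathered into one function so that the
    fundamental theorem of calculus is applied once. *)
Let flux e r := - lambda * (F1 r * F r ^+ m * profile a rho e r ^+ 2) +
  kappa * (F r ^+ m.+1 * (profile a rho e r * profile1 a rho e r)).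
Let flux1 e r :=
  - lambda * ((F2 r * F r ^+ m + F1 r * (m%:R * F r ^+ m.-1 * F1 r)) * profile a rho e r ^+ 2 +
    F1 r * F r ^+ m * (2%:R * profile a rho e r ^+ 1 * profile1 a rho e r)) +
  kappa * ((m.+1%:R * F r ^+ m * F1 r) * (profile a rho e r * profile1 a rho e r) +
    F r ^+ m.+1 * (profile1 a rho e r * profile1 a rho e r +
      profile a rho e r * profile2 a rho e r)).

Let is_derive_flux e r : 0 < e -> is_derive r 1 (flux e) (flux1 e r).
Proof.
move=> e0; have dp r := is_derive_profile rho a_gt0 e0 r.
have dp1 r := is_derive_profile1 a_gt0 rho_gt0 e0 r.
apply: is_derive_eq (is_derive_add
  (is_derive_mul (is_derive_const (- lambda) r 1)
    (is_derive_mul (is_derive_mul (dF1 r) (is_derive_pow m (dF r))) (is_derive_pow 2 (dp r))))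
  (is_derive_mul (is_derive_const kappa r 1)
    (is_derive_mul (is_derive_pow m.+1 (dF r)) (is_derive_mul (dp r) (dp1 r))))) _.
by rewrite !mul0r !add0r.
Qed.

Let ricci_formE e r : ricci_form e r = flux1 e r +
  F r ^+ m.+1 * ((1 - kappa) * profile1 a rho e r ^+ 2 -
    kappa * (profile a rho e r * profile2 a rho e r)) +
  lambda * m%:R * F r ^+ m.-1 * profile a rho e r ^+ 2.
Proof.
rewrite /ricci_form /flux1.
have -> : F r ^+ m.+1 = F r * F r ^+ m by rewrite exprS.
have -> : lambda = kappa * m.+1%:R / 2 by rewrite kappaM; field.
by move: (F r ^+ m) (F r ^+ m.-1) => Fm Fm1; field.
Qed.

Let pow_young x : 0 <= x -> x ^+ m.-1 <= x ^+ m.+1 / rho ^+ 2 + rho ^+ m.-1.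
Proof.
move=> x0; have r0 := ltW rho_gt0.
have [xr|rx] := leP x rho.
  apply: (@le_trans _ _ (rho ^+ m.-1)); first by rewrite lerXn2r ?nnegrE.
  by rewrite lerDr divr_ge0 ?exprn_ge0.
case: (m) => [|k] /=; first by rewrite !expr0 lerDr divr_ge0 ?exprn_ge0.
apply: (@le_trans _ _ (x ^+ k.+2 / rho ^+ 2)); last by rewrite lerDl exprn_ge0.
rewrite ler_pdivlMr ?exprn_gt0// -[k.+2]addn2 exprD ler_wpM2l ?exprn_ge0//.
by rewrite lerXn2r ?nnegrE ?(ltW rx).
Qed.

Lemma volume_integral_le e M B : 0 < e -> e <= rho / 4 -> 0 <= M -> 0 <= B ->
  (forall r, 0 < e ->
    (1 - kappa) * profile1 a rho e r ^+ 2 - kappa * (profile a rho e r * profile2 a rho e r) <=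
    - (c0 * profile a rho e r ^+ 2 / rho ^+ 2) +
    M * (e ^+ 2 / smoothed_radius e r ^+ 3 / rho)) ->
  (forall r, 0 <= r -> r <= rho -> F r ^+ m.+1 <= B * r) ->
  (0 <= \int[@lebesgue_measure R]_(r in `[0%R, rho]) (ricci_form e r)%:E)%E ->
  ((expR (- (4 * a)) ^+ 2 / rho ^+ 2)%:E *
     \int[@lebesgue_measure R]_(r in `[0%R, (rho / 2)%R]) (F r ^+ m.+1)%:E <=
   (lambda * m.+1%:R * rho ^+ m + M * B / rho * e)%:E)%E.
Proof.
move=> e0 e4 M0 B0 W FB K0.
pose V r := F r ^+ m.+1 * profile a rho e r ^+ 2 / rho ^+ 2.
(* An antiderivative of the whole upper bound: the flux, the smoothing error, since [- e^2 / s] has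
   derivative [e^2 r / s^3], and the constant left by [pow_young]. *)
pose G r := flux e r + - (M * B / rho) * (e ^+ 2 * (smoothed_radius e r)^-1) +
  lambda * m%:R * rho ^+ m.-1 * r.
pose G' r := flux1 e r + M * B / rho * (e ^+ 2 * r / smoothed_radius e r ^+ 3) +
  lambda * m%:R * rho ^+ m.-1.
have s0 r : smoothed_radius e r != 0 by rewrite gt_eqF// smoothed_radius_gt0.
have dG r : is_derive r 1 G (G' r).
  have ds := is_derive_inv (s0 r) (is_derive_smoothed_radius e0 r).
  apply: is_derive_eq (is_derive_add (is_derive_add (is_derive_flux r e0)
    (is_derive_mul (is_derive_const (- (M * B / rho)) r 1)
      (is_derive_mul (is_derive_const (e ^+ 2) r 1) ds)))
    (is_derive_mul (is_derive_const (lambda * m%:R * rho ^+ m.-1) r 1) (is_derive_id r 1))) _.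
  rewrite /G' !mul0r !add0r mulr1; congr (_ + _ + _).
  by field; rewrite s0 gt_eqF.
have cp := continuous_derive (fun r => is_derive_profile rho a_gt0 e0 r).
have cp1 := continuous_derive (fun r => is_derive_profile1 a_gt0 rho_gt0 e0 r).
have cp2 : continuous (profile2 a rho e) by exact: continuous_profile2.
have cV : continuous V by rewrite /V; cont.
have cK := continuous_ricci_form e0.
have cs : continuous (smoothed_radius e).
  exact: continuous_derive (fun r => is_derive_smoothed_radius e0 r).
have cG' : continuous G'.
  apply: cD; last exact: cC.
  apply: cD; first by rewrite /flux1; cont.
  apply: cM; first exact: cC.
  apply: cM; first by apply: cM; [exact: cC|move=> r; exact: cvg_id].
  have cs3 : continuous (fun r => smoothed_radius e r ^+ 3) by cont.
  by move=> r; apply: (cvgV _ (cs3 r)); rewrite expf_neq0.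
have KVG r : 0 <= r -> r <= rho -> ricci_form e r + V r <= G' r.
  move=> r0 rr; rewrite ricci_formE /V /G'.
  set P := profile a rho e r; set Q := F r ^+ m.+1.
  have Q0 : 0 <= Q by rewrite exprn_ge0// F_ge0.
  set w := e ^+ 2 / smoothed_radius e r ^+ 3 / rho.
  have w0 : 0 <= w.
    by rewrite !divr_ge0 ?exprn_ge0 ?(ltW rho_gt0) ?(ltW (smoothed_radius_gt0 e0 r)) ?(ltW e0).
  have P1 : P ^+ 2 <= 1.
    by rewrite exprn_ile1 ?profile_ge0// profile_le1.
  have P0 : 0 <= P ^+ 2 by exact: sqr_ge0.
  have lQW := ler_wpM2l Q0 (W r e0); rewrite -/P -/w -/Q in lQW.
  have lQB : Q * (M * w) <= B * r * (M * w).
    by apply: ler_wpM2r; [rewrite mulr_ge0|exact: FB].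
  have lyoung : lambda * m%:R * F r ^+ m.-1 * P ^+ 2 <=
      lambda * m%:R * (Q * P ^+ 2 / rho ^+ 2) + lambda * m%:R * rho ^+ m.-1.
    rewrite -mulrA -mulrDr; apply: ler_wpM2l => //.
    apply: (@le_trans _ _ ((Q / rho ^+ 2 + rho ^+ m.-1) * P ^+ 2)).
      by apply: ler_wpM2r => //; apply: pow_young; exact: F_ge0.
    rewrite mulrDl; apply: lerD; first by rewrite mulrAC.
    by rewrite ler_piMr// exprn_ge0// ltW.
  have wE : M * B / rho * (e ^+ 2 * r / smoothed_radius e r ^+ 3) = B * r * (M * w).
    by rewrite /w; field; rewrite s0 gt_eqF.
  have QE : Q * (- (c0 * P ^+ 2 / rho ^+ 2) + M * w) =
      Q * (M * w) - lambda * m%:R * (Q * P ^+ 2 / rho ^+ 2) - Q * P ^+ 2 / rho ^+ 2.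
    by rewrite /c0; field; rewrite gt_eqF.
  rewrite wE; rewrite QE in lQW.
  move: lQW lQB lyoung.
  set t1 := Q * (_ - _); set t2 := lambda * m%:R * (Q * _ / _).
  set t3 := Q * (M * w); set t4 := B * r * (M * w); set t5 := Q * P ^+ 2 / _.
  by lra.
have mD : measurable ([set` `[0, rho]] : set (measurableTypeR R)).
  exact: measurable_itv.
have cI (f : R -> R) b : continuous f ->
    (@lebesgue_measure R).-integrable [set` `[0, b]] (EFin \o f).
  move=> cf; apply: continuous_compact_integrable; first exact: segment_compact.
  exact: continuous_subspaceT.
have intKV : (\int[@lebesgue_measure R]_(r in `[0%R, rho]) (V r)%:E <= (G rho - G 0)%:E)%E.
  rewrite -(integral_is_derive rho_gt0 dG cG').
  apply: (@le_trans _ _ (\int[@lebesgue_measure R]_(r in `[0%R, rho]) (ricci_form e r)%:E +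
      \int[@lebesgue_measure R]_(r in `[0%R, rho]) (V r)%:E)%E).
    by rewrite leeDr.
  rewrite -(integralD mD (cI _ _ cK) (cI _ _ cV)).
  apply: le_integral_nonmeasurable => r; rewrite /patch; case: ifP => //.
  by rewrite inE/= in_itv/= => /andP[r0 rr]; rewrite lee_fin KVG.
have Glow : G rho - G 0 <= lambda * m.+1%:R * rho ^+ m + M * B / rho * e.
  have rs := le_smoothed_radius e rho.
  have [p0 p10 _] := profile_eq0 a rho_gt0 rs.
  have s00 : smoothed_radius e 0 = e.
    by rewrite /smoothed_radius expr0n/= add0r sqrtr_sqr gtr0_norm.
  have lam0 := ltW lambda_gt0.
  have flux_rho : flux e rho = 0.
    by rewrite /flux p0 p10 expr0n/= !mulr0 addr0.
  (* [0 ^+ m] is 1 for [m = 0] and 0 otherwise: only in dimension 2 does the boundary term at the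
     origin survive. *)
  have flux_0 : - flux e 0 <= lambda * 0 ^+ m.
    rewrite /flux F_0 F1_0 (exprS 0 m) !mul0r mulr0 addr0 mul1r mulNr opprK.
    apply: ler_wpM2l => //; apply: ler_piMr; first by rewrite exprn_ge0.
    by rewrite exprn_ile1 ?profile_ge0// profile_le1.
  have pow0 : lambda * 0 ^+ m + lambda * m%:R * rho ^+ m.-1 * rho <=
      lambda * m.+1%:R * rho ^+ m.
    rewrite -!mulrA -mulrDr; apply: ler_wpM2l => //.
    case: (m) => [|k] /=; first by rewrite !expr0 mul0r addr0 mulr1.
    rewrite expr0n/= add0r -exprSr; apply: ler_wpM2r; first by rewrite exprn_ge0// ltW.
    by rewrite ler_nat.
  have MB0 : 0 <= M * B / rho by rewrite divr_ge0 ?mulr_ge0// ltW.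
  have erho : 0 <= M * B / rho * (e ^+ 2 * (smoothed_radius e rho)^-1).
    by rewrite mulr_ge0// mulr_ge0 ?exprn_ge0 ?invr_ge0 ?(ltW e0) ?(ltW (smoothed_radius_gt0 e0 rho)).
  have ee : e ^+ 2 * e^-1 = e by rewrite expr2 mulfK// gt_eqF.
  rewrite /G flux_rho s00 ee mulr0 addr0 !mulNr add0r opprD opprK.
  by move: flux_0 pow0 erho; lra.
have half : (0 : R) < rho / 2 by rewrite divr_gt0.
pose b := expR (- (4 * a)) ^+ 2 / rho ^+ 2.
have b0 : 0 <= b by rewrite divr_ge0 ?sqr_ge0.
have cFm : continuous (fun r => F r ^+ m.+1) by cont.
have mD2 : measurable ([set` `[0, rho / 2]] : set (measurableTypeR R)).
  exact: measurable_itv.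
rewrite -/b -(integralZl mD2 (cI _ _ cFm)).
apply: le_trans (le_trans intKV _); last by rewrite lee_fin.
(* [V] is non-negative on [[0, rho]], and on the first half of it the profile is bounded below by
   [profile_ge]. *)
apply: le_integral_nonmeasurable => r; rewrite /patch !mem_setE !in_itv/=.
case: ifPn => [/andP[r0 r2]|_]; last first.
  case: ifPn => [/andP[r0 _]|//]; rewrite lee_fin /V divr_ge0 ?sqr_ge0//.
  by rewrite mulr_ge0 ?sqr_ge0// exprn_ge0// F_ge0.
have rr : r <= rho by apply: le_trans r2 _; move: rho_gt0; lra.
rewrite r0 rr/= -EFinM lee_fin /V.
have -> : b * F r ^+ m.+1 = F r ^+ m.+1 * expR (- (4 * a)) ^+ 2 / rho ^+ 2.
  by rewrite /b mulrC mulrA.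
apply: ler_wpM2r; first by rewrite invr_ge0 sqr_ge0.
apply: ler_wpM2l; first by rewrite exprn_ge0// F_ge0.
by rewrite lerXn2r ?nnegrE ?expR_ge0 ?profile_ge0// profile_ge.
Qed.

Lemma volume_integral_bound :
  (forall e, 0 < e ->
    (0 <= \int[@lebesgue_measure R]_(r in `[0%R, rho]) (ricci_form e r)%:E)%E) ->
  (\int[@lebesgue_measure R]_(r in `[0%R, (rho / 2)%R]) (F r ^+ m.+1)%:E <=
   (lambda * m.+1%:R * expR (8 * a) * rho ^+ m.+2)%:E)%E.
Proof.
move=> K0.
have [M M0 W] := profile_form_le; have [B B0 FB] := pow_F_le.
have cFm : continuous (fun r => F r ^+ m.+1) by cont.
have Ifin : (\int[@lebesgue_measure R]_(r in `[0%R, (rho / 2)%R]) (F r ^+ m.+1)%:E)%E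
    \is a fin_num.
  apply: integrable_fin_num; first exact: measurable_itv.
  apply: continuous_compact_integrable; first exact: segment_compact.
  exact: continuous_subspaceT.
move: (@volume_integral_le) => Vle.
set I := (\int[_]_(_ in _) _)%E in Ifin Vle *.
rewrite -(fineK Ifin) in Vle *; rewrite lee_fin.
pose b := expR (- (4 * a)) ^+ 2 / rho ^+ 2.
have b0 : 0 < b by rewrite divr_gt0 ?exprn_gt0 ?expR_gt0.
suff : b * fine I <= lambda * m.+1%:R * rho ^+ m.
  rewrite -ler_pdivlMl//; move=> /le_trans; apply.
  rewrite le_eqVlt; apply/orP; left; apply/eqP.
  have bE : expR (- (4 * a)) ^+ 2 = (expR (8 * a))^-1.
    by rewrite -expRM_natl -expRN; congr expR; ring.
  rewrite /b bE -[m.+2]addn2 exprD; field.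
  by rewrite !gt_eqF// expR_gt0.
apply/ler_addgt0Pr => d d0.
pose N := M * B / rho; have N0 : 0 <= N by rewrite divr_ge0 ?mulr_ge0// ltW.
(* The first bound is required by [profile_ge]; the second makes the error at most [d], with [N + 1]
   because [N] may be 0. *)
pose e := Num.min (rho / 4) (d / (N + 1)).
have e0 : 0 < e by rewrite lt_min !divr_gt0// ltr_wpDl.
have e4 : e <= rho / 4 by rewrite ge_min lexx.
have eN : N * e <= d.
  apply: (@le_trans _ _ ((N + 1) * e)); first by rewrite ler_wpM2r ?(ltW e0)// lerDl.
  by rewrite mulrC -ler_pdivlMr ?ltr_wpDl// ge_min lexx orbT.
have := Vle e M B e0 e4 M0 B0 (fun r => W e r) FB (K0 e e0).
by rewrite -EFinM lee_fin => /le_trans; apply; rewrite lerD2l.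
Qed.

End FixedRadius.
End RadialInequality.

(** * Volume growth *)

Section RadialIntegrals.
Context (R : realType) (m : nat).
Local Notation T := (measurableTypeR R).
Implicit Types (K : R -> R) (c rho : R).

(* The value [c] at the origin is arbitrary since a point is negligible. *)
Definition radial_integrand K c rho (s : R) : R :=
  if s == 0 then c else if 0 < s < rho then K s / s ^+ m.+1 else 0.

Lemma measurable_radial_integrand K c rho : continuous K ->
  measurable_fun [set: T] (radial_integrand K c rho : T -> R).
Proof.
move=> cK.
have mK : measurable_fun [set: T] (K : T -> R) by exact: continuous_measurable_fun.
rewrite (_ : radial_integrand K c rho = fun s => if s == 0 then c else
    if 0 < s < rho then K s * expR (- ln s) ^+ m.+1 else 0); last first.
  apply/funext => s; rewrite /radial_integrand; case: ifP => // _.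
  by case: ifP => // /andP[s0 _]; rewrite expRN lnK ?posrE// exprVn.
apply: measurable_fun_ifT => //; first exact: measurable_fun_eqr.
apply: measurable_fun_ifT => //.
  by apply: measurable_and => //; exact: measurable_fun_ltr.
apply: measurable_funM => //; apply: measurable_funX.
by apply: measurableT_comp => //; apply: measurableT_comp.
Qed.

(** The power of [s] dividing [K] cancels the one in the polar density. As [K] may change sign,
    positive and negative parts are treated separately. *)
Lemma integral_radial K c rho : 0 < rho -> continuous K ->
  (\int[lebesgue_tuple R m.+2]_t (radial_integrand K c rho (radius t))%:E =
   (unit_ball_volume R m.+2 * m.+2%:R)%:E *
     \int[@lebesgue_measure R]_(r in `[0%R, rho]) (K r)%:E)%E.
Proof.
move=> rho0 cK; pose k := radial_integrand K c rho.
set w := unit_ball_volume R m.+2 * m.+2%:R.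
have w0 : 0 <= w by rewrite mulr_ge0// unit_ball_volume_ge0.
have mk : measurable_fun [set: T] (EFin \o k : T -> \bar R).
  by apply/measurable_EFinP; exact: measurable_radial_integrand.
have dens0 := @radial_density_ge0 R m.+1.
have kd s : ((k s)%:E * (radial_density m.+1 s)%:E =
    ((fun r => (w * K r)%:E) \_ `]0%R, rho[) s)%E.
  rewrite /patch mem_setE in_itv/= -EFinM /k /radial_integrand /radial_density.
  have [->|s0] := eqVneq s 0; first by rewrite ltxx mulr0.
  case: (ltP 0 s) => [s_gt0|_]; last by rewrite mulr0.
  case: ifP => _; last by rewrite mul0r.
  congr EFin; rewrite /w; have : s ^+ m.+1 != 0 by rewrite expf_neq0.
  by move: (s ^+ m.+1) (m.+2%:R) => x y x0; field.
have pos s : ((EFin \o k)^\+ s * (radial_density m.+1 s)%:E =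
    ((fun r => (w * K r)%:E) \_ `]0%R, rho[)^\+ s)%E.
  rewrite [RHS]funeposE -kd funeposE -EFinM -!EFin_max -EFinM.
  by congr EFin; rewrite maxr_pMl// mul0r.
have neg s : ((EFin \o k)^\- s * (radial_density m.+1 s)%:E =
    ((fun r => (w * K r)%:E) \_ `]0%R, rho[)^\- s)%E.
  rewrite [RHS]funenegE -kd funenegE -EFinM -!EFinN -!EFin_max -EFinM.
  by congr EFin; rewrite maxr_pMl// mul0r mulNr.
transitivity (\int[@lebesgue_measure R]_s
    ((fun r => (w * K r)%:E) \_ `]0%R, rho[) s)%E.
  rewrite integralE [RHS]integralE; congr (_ - _)%E.
    under [RHS]eq_integral do rewrite -pos.
    rewrite -ge0_integral_radius//; last exact: measurable_funepos.
    by apply: eq_integral => t _; rewrite !funeposE.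
  under [RHS]eq_integral do rewrite -neg.
  rewrite -ge0_integral_radius//; last exact: measurable_funeneg.
  by apply: eq_integral => t _; rewrite !funenegE.
rewrite -integral_mkcond -(@integral_itv_bndoo _ _ _ _ true false); last first.
  apply/measurable_EFinP/measurable_funTS; apply: measurable_funM => //.
  exact: continuous_measurable_fun.
under eq_integral do rewrite EFinM.
have mD : measurable ([set` `[0, rho]] : set T) by exact: measurable_itv.
have iK : (@lebesgue_measure R).-integrable [set` `[0, rho]] (EFin \o K).
  apply: continuous_compact_integrable; first exact: segment_compact.
  exact: continuous_subspaceT.
by rewrite -(integralZl mD iK).
Qed.

End RadialIntegrals.

(** * Reduction of volume and quadratic form to integrals over the half-line *)

Section SchrodingerComparison.
Context (R : realType) (m : nat) (lambda : R).
Context (J F F1 F2 : R -> R) (g : 'rV[R]_m.+2 -> 'M[R]_m.+2).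
Hypothesis lambda_gt : m.+1%:R / 4 < lambda.
Hypothesis gJ : rotationally_symmetric g J.
Hypothesis FJ : forall r : R, 0 <= r -> F r = J r.
Hypothesis J_gt0 : forall r : R, 0 < r -> 0 < J r.
Hypothesis dF : forall r : R, is_derive r 1 F (F1 r).
Hypothesis dF1 : forall r : R, is_derive r 1 F1 (F2 r).
Hypothesis cF2 : continuous F2.

Let w := unit_ball_volume R m.+2 * m.+2%:R.

Let F_gt0 (r : R) : 0 < r -> 0 < F r.
Proof. by move=> r0; rewrite FJ ?ltW// J_gt0. Qed.

Let radius0 (t : m.+2.-tuple (measurableTypeR R)) :
  (row_of_tuple t == 0) = (radius t == 0).
Proof.
apply/eqP/eqP => [|r0]; first by rewrite /radius => ->; exact: enorm0.
by apply/eqP; apply: contraTT isT => /enorm_gt0; rewrite -/(radius t) r0 ltxx.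
Qed.

Let is_derive_pow_F k (r : R) : is_derive r 1 (fun r : R => F r ^+ k) (k%:R * F r ^+ k.-1 * F1 r).
Proof. exact: is_derive_pow. Qed.

Lemma volume_le (r : R) : 0 < r ->
  (volume g (geodesic_ball g 0 r) <=
   w%:E * \int[@lebesgue_measure R]_(s in `[0%R, r]) (F s ^+ m.+1)%:E)%E.
Proof.
move=> r0.
have cFm : continuous (fun s => F s ^+ m.+1).
  move=> s; apply/differentiable_continuous/derivable1_diffP.
  by case: (is_derive_pow_F m.+1 s).
rewrite -(@integral_radial R m _ (Num.sqrt (\det (g 0))) r r0 cFm).
apply: le_integral_nonmeasurable => t; rewrite /patch [t \in [set: _]]mem_setT mul1r.
rewrite /radial_integrand -radius0.
have [t0|t0] := eqVneq (row_of_tuple t) 0.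
  by rewrite t0; case: ifP => // _; rewrite lee_fin sqrtr_ge0.
have s0 : 0 < radius t by exact: enorm_gt0.
rewrite s0/=; case: ifPn => [/set_mem/= /(geodesic_ball_subset gJ)/=|_].
  rewrite -/(radius t) => tr.
  rewrite tr lee_fin (sqrt_det_metric gJ J_gt0 t0) -/(radius t).
  by rewrite FJ ?(ltW s0)// expr_div_n.
case: ifP => // _.
by rewrite lee_fin divr_ge0// exprn_ge0 ?(ltW (F_gt0 s0)) ?(ltW s0).
Qed.

Lemma ricci_form_integral_ge0 (rho e : R) : 0 < rho -> 0 < e -> 0 < w ->
  schrodinger_nonneg g lambda ->
  (0 <= \int[@lebesgue_measure R]_(r in `[0%R, rho])
          (ricci_form m lambda F F1 F2 rho e r)%:E)%E.
Proof.
move=> rho0 e0 w0 gS.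
have a0 : 0 < bump_scale m lambda by exact: lt_le_trans ltr01 (bump_scale_ge1 lambda_gt).
set phi := fun x : 'rV[R]_m.+2 => profile (bump_scale m lambda) rho e (enorm x).
have tphi : test_function phi by exact: test_function_profile.
have cK : continuous (ricci_form m lambda F F1 F2 rho e).
  exact: continuous_ricci_form.
set f := fun x => sqnorm_d g phi x + lambda * lowest_ricci g x * phi x ^+ 2.
rewrite -(@pmule_rge0 _ w%:E) ?lte_fin//.
(* Again the value at the origin is that of the original integrand, so the two sides agree there. *)
rewrite -(@integral_radial R m _ (f 0 * Num.sqrt (\det (g 0))) rho rho0 cK).
apply: le_trans (gS phi tphi) _.
apply: le_integral_nonmeasurable => t; rewrite /patch !mem_setT lee_fin.
rewrite -/(f (row_of_tuple t)) /radial_integrand -radius0.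
have [->//|t0] := eqVneq (row_of_tuple t) 0.
set x := row_of_tuple t in t0 *; set s := radius t.
have s0 : 0 < s by exact: enorm_gt0.
have sn0 : s != 0 by rewrite gt_eqF.
have Fs := F_gt0 s0.
have J0 : 0 <= (J s / s) ^+ m.+1 by rewrite exprn_ge0// divr_ge0 ?ltW ?J_gt0.
rewrite (sqrt_det_metric gJ J_gt0 t0) -[enorm x]/s.
set p := profile (bump_scale m lambda) rho e s.
set p1 := profile1 (bump_scale m lambda) rho e s.
have sq : sqnorm_d g phi x = p1 ^+ 2.
  apply: (sqnorm_d_radial gJ FJ J_gt0 t0) => i.
  have := is_derive_radial (delta_mx 0 i) t0 (is_derive_profile rho a0 e0 (enorm x)).
  by case=> _; rewrite /partial => ->; rewrite dot_delta.
have ric := lowest_ricci_le gJ FJ J_gt0 dF dF1 (isT : (2 <= m.+2)%N) t0.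
rewrite -[enorm x]/s in ric.
have lam0 := lambda_gt0 lambda_gt.
have fle : f x <= p1 ^+ 2 + lambda * tangential_ricci m.+2 F F1 F2 s * p ^+ 2.
  rewrite /f sq lerD2l; apply: ler_wpM2r; first exact: sqr_ge0.
  by apply: ler_wpM2l => //; exact: ltW.
apply: le_trans (ler_wpM2r J0 fle) _; rewrite s0/=.
case: ifPn => [srho|]; last first.
  rewrite -leNgt => rs; have := le_trans rs (le_smoothed_radius e s).
  move=> /(profile_eq0 (bump_scale m lambda) rho0)[p_0 p1_0 _].
  by rewrite /p /p1 p_0 p1_0 expr0n/= mulr0 addr0 mul0r.
rewrite /ricci_form -/p -/p1 -FJ ?(ltW s0)// expr_div_n mulrA.
apply: ler_wpM2r; first by rewrite invr_ge0 exprn_ge0// ltW.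
rewrite le_eqVlt; apply/orP; left; apply/eqP.
rewrite /tangential_ricci -[m.+2]addn2 natrD addrK.
have Fn0 : F s != 0 by rewrite gt_eqF.
case: (m) => [|k].
  by rewrite /= expr0 expr1; field.
by rewrite /= !exprS; field.
Qed.

End SchrodingerComparison.

(** Transfers the one-sided condition [J'(0) = 1] to the extension [F], by uniqueness of the limit
    from the right. *)
Lemma right_derivative_is_derive (R : realType) (J F : R -> R) (l l' : R) :
  is_derive (0 : R) 1 F l -> (forall r, 0 <= r -> F r = J r) ->
  right_derivative_at0 J l' -> l = l'.
Proof.
move=> [dF <-] FJ J'; apply: (@cvg_unique _ _ ((fun h => (J h - J 0) / h) @ 0^'+)) => //.
have cF : h^-1 *: ((F \o shift 0) (h *: (1 : R)) - F 0) @[h --> 0^'] --> 'D_1 F 0 by [].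
apply: (cvg_trans _ (cvg_dnbhs_at_right cF)); apply: near_eq_cvg; near=> h.
have h0 : 0 < h by near: h; exact: nbhs_right_gt.
by rewrite /= addr0 [h *: 1]mulr1 -!FJ// ?(ltW h0)// mulrC.
Unshelve. all: by end_near. Qed.

Theorem theoremG (R : realType) (n : nat) (lambda : R)
    (hn : (2 <= n)%N) (hlambda : (n%:R - 1) / 4 < lambda) :
  exists c : R,
    forall (J : R -> R) (g : 'rV[R]_n -> 'M[R]_n),
      smooth_half_line J ->
      J 0 = 0 ->
      right_derivative_at0 J 1 ->
      (forall r : R, 0 < r -> 0 < J r) ->
      riemannian_metric g ->
      rotationally_symmetric g J ->
      schrodinger_nonneg g lambda ->
      forall r : R, 0 < r ->
        (volume g (geodesic_ball g 0 r) <= (c * r ^+ n)%:E)%E.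
Proof.
case: n hn hlambda => [//|[//|m]] _ hlambda.
have lambda_gt : m.+1%:R / 4 < lambda.
  by move: hlambda; rewrite -[m.+2]addn1 natrD addrK.
set w := unit_ball_volume R m.+2 * m.+2%:R.
pose C := lambda * m.+1%:R * expR (8 * bump_scale m lambda).
(* [w] stands for the area of the unit sphere; the power of 2 arises because a bump of radius
   [2 * r] controls the volume only up to radius [r]. *)
exists (w * (C * 2 ^+ m.+2)) => J g [F [Fsm FJ]] J0 J1 J_gt0 _ gJ gS r r0.
pose F1 := F^`()%classic; pose F2 := F1^`()%classic.
have dF (s : R) : is_derive s 1 F (F1 s).
  by split; [have := Fsm 0%N s; rewrite derive1n0|rewrite /F1 derive1E].
have dF1 (s : R) : is_derive s 1 F1 (F2 s).
  by split; [have := Fsm 1%N s; rewrite derive1n1|rewrite /F2 derive1E].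
have cF2 : continuous F2.
  move=> s; apply/differentiable_continuous/derivable1_diffP.
  by have := Fsm 2%N s; rewrite derive1nS derive1n1.
have F_0 : F 0 = 0 by rewrite FJ.
have F1_0 : F1 0 = 1 by apply: right_derivative_is_derive (dF 0) FJ J1.
have F_gt0 (s : R) : 0 < s -> 0 < F s by move=> s0; rewrite FJ ?ltW// J_gt0.
apply: le_trans (volume_le gJ FJ J_gt0 dF r0) _; rewrite -/w.
have w0 : 0 <= w by rewrite mulr_ge0// unit_ball_volume_ge0.
(* The comparison divides by [w]; for [w = 0] the bound is immediate, which spares a proof that the
   unit ball has positive volume. *)
have [->|wn0] := eqVneq w 0; first by rewrite !mul0r mul0e.
have w_gt0 : 0 < w by rewrite lt_neqAle eq_sym wn0.
have r2 : 0 < 2 * r by rewrite mulr_gt0.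
have := volume_integral_bound lambda_gt dF dF1 cF2 F_0 F1_0 F_gt0 r2
  (fun e e0 => ricci_form_integral_ge0 lambda_gt gJ FJ J_gt0 dF dF1 cF2 r2 e0 w_gt0 gS).
rewrite -/C [2 * r / 2]mulrAC divff// mul1r exprMn => Ile.
have -> : (w * (C * 2 ^+ m.+2) * r ^+ m.+2)%:E =
    (w%:E * (C * (2 ^+ m.+2 * r ^+ m.+2))%:E)%E by rewrite -EFinM !mulrA.
by rewrite lee_pmul2l ?lte_fin.
Qed.
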